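(* Let $X=(X,d)$ be an arbitrary ultrametric Polish space. Then the $\mathsf{UCont}(d)$-hierarchy on the Borel subsets of $X$ is very good. If moreover $X$ has bounded diameter, then the $\mathsf{Lip}(d)$-hierarchy on the Borel subsets of $X$ is very good as well.
   Context: Work in ZF + DC($\mathbb{R}$). An ultrametric Polish space is a separable metric space $(X,d)$ where $d$ is a complete ultrametric ($d(x,z)\le\max\{d(x,y),d(y,z)\}$), with the topology induced by $d$. $X$ has bounded diameter if $\sup\{d(x,y):x,y\in X\}<\infty$. $\mathsf{UCont}(d)$ is the set of uniformly continuous maps $X\to X$; $\mathsf{Lip}(d)$ is the set of maps $f\colon X\to X$ that are Lipschitz with some constant $L\ge0$ ($d(f(x),f(y))\le L\,d(x,y)$). For a set $\mathcal F$ of self-maps of $X$ closed under composition and containing the identity, and $A,B\subseteq X$, write $A\le_{\mathcal F}B$ iff $A=f^{-1}(B)$ for some $f\in\mathcal F$, $A<_{\mathcal F}B$ iff $A\le_{\mathcal F}B$ and $B\not\le_{\mathcal F}A$, and $\neg A=X\setminus A$. The $\mathcal F$-hierarchy on a class $\Gamma\subseteq\mathscr P(X)$ is the quotient of $(\Gamma,\le_{\mathcal F})$ by the associated equivalence. It is very good if (i) for all $A,B\in\Gamma$, $A\le_{\mathcal F}B$ or $\neg B\le_{\mathcal F}A$, and (ii) there is no sequence $(A_n)$ in $\Gamma$ with $A_{n+1}<_{\mathcal F}A_n$ for all $n$. *)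

(* Defs.v *)
From HB Require Import structures.
From mathcomp Require Import all_boot all_order all_algebra.
From mathcomp Require Import boolp classical_sets functions cardinality.
From mathcomp Require Import reals topology measure.

Set Implicit Arguments.
Unset Strict Implicit.
Unset Printing Implicit Defensive.

Import Order.TTheory GRing.Theory Num.Theory.

Local Open Scope classical_set_scope.
Local Open Scope ring_scope.

Section Spaces.
Context {R : realType}.
Implicit Type X : metricType R.

Definition ultrametric X : Prop :=
  forall x y z : X, mdist x z <= Num.max (mdist x y) (mdist y z).

Definition separable X : Prop :=
  exists2 S : set X, countable S & dense S.

(* Stated on sequences because the library's [completeType] is pointed, which
   would exclude the empty space. *)
Definition complete X : Prop :=
  forall u : nat -> X, cauchy (u @ \oo) -> exists x : X, u @ \oo --> x.

Definition ultrametric_Polish X : Prop :=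
  [/\ ultrametric X, complete X & separable X].

Definition bounded_diameter X : Prop :=
  has_ubound [set mdist x y | x in [set: X] & y in [set: X]].

Definition Borel X : set (set X) := <<s @open X >>.

Definition UCont X : set (X -> X) := [set f | unif_continuous f].

Definition Lip X : set (X -> X) :=
  [set f | exists2 L : R, 0 <= L &
    forall x y : X, mdist (f x) (f y) <= L * mdist x y].

End Spaces.

Section Hierarchies.
Context {T : Type}.
Implicit Types (F : set (T -> T)) (A B : set T) (Gamma : set (set T)).

Definition reducibility_class F : Prop :=
  F id /\ forall f g, F f -> F g -> F (f \o g).

Definition reducible F A B : Prop := exists2 f, F f & A = f @^-1` B.

Definition strictly_reducible F A B : Prop :=
  reducible F A B /\ ~ reducible F B A.

(* Both clauses depend only on the [F]-equivalence classes of the sets involved,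
   so the quotient of [Gamma] need not be formed. *)
Definition very_good_hierarchy F Gamma : Prop :=
  (forall A B, Gamma A -> Gamma B -> reducible F A B \/ reducible F (~` B) A) /\
  ~ (exists2 A : nat -> set T, (forall n, Gamma (A n)) &
       forall n, strictly_reducible F (A n.+1) (A n)).

End Hierarchies.

Lemma UCont_reducibility_class (R : realType) (X : metricType R) :
  reducibility_class (@UCont R X).
Proof.
split=> [E entE|f g fu gu E entE]; last exact: gu _ (fu _ entE).
by apply: filterS entE => -[].
Qed.

Lemma Lip_reducibility_class (R : realType) (X : metricType R) :
  reducibility_class (@Lip R X).
Proof.
split=> [|f g [L L0 fL] [K K0 gK]]; first by exists 1 => // x y; rewrite mul1r.
exists (L * K) => [|x y]; first exact: mulr_ge0.
by rewrite (le_trans (fL _ _))// -mulrA ler_wpM2l.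
Qed.

(* Main.v *)
Require Import Defs.
From mathcomp Require Import all_boot all_order all_algebra.
From mathcomp Require Import boolp classical_sets reals topology measure.
From mathcomp Require Import zify lra.

(** Rounding the distance to powers of two turns the space into the branches of
a tree of balls, so that a map sending balls of level [n] into balls of level
[n] is uniformly continuous, and Lipschitz when the diameter is bounded. In the
Wadge game the players build points [x] and [y] ball by ball, and II wins iff
[x \in A <-> y \in B]: a winning strategy for II reduces [A] to [B], one for I
reduces the complement of [B] to [A] by a contraction. The game is determined by
Martin's inductive proof of Borel determinacy: every Borel payoff becomes clopen
in a suitable covering of the game tree. Along a descending sequence, I wins the
games for both [A n.+1] and its complement; choosing between these strategies
along [z : nat -> bool] yields (Martin-Monk) a Borel subset of the Cantor space
that changes membership whenever one bit is flipped, which contradicts the Baire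
property. *)

Set Implicit Arguments.
Unset Strict Implicit.
Unset Printing Implicit Defensive.

(** * Game trees *)

(** A strategy for I yields a contraction because I moves first: II's balls up to level [n] already
    determine his ball of level [n.+1]. This gain of one level makes the infinite composition of the
    maps chosen along [z] converge, whatever point it starts from, with a limit that depends
    continuously on [z].

    In Borel determinacy the obstacle is a countable union: each set becomes clopen in a covering of
    its own, but all of them must be treated at once. They are unravelled one after another along a
    tower of coverings. The [i]-th covering changes nothing up to level [k + i], so every level is
    eventually fixed and the tower has a limit tree. There all the sets are clopen, so their union
    is open, and one more unfolding makes it clopen. *)

Section Selection.
Variable A : Type.

Definition some_such (d : A) (P : A -> Prop) : A :=
  if pselect (exists a, P a) is left h then projT1 (cid h) else d.

Lemma some_suchP d (P : A -> Prop) : (exists a, P a) -> P (some_such d P).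
Proof.
by rewrite /some_such => exP; case: pselect => // h; exact: (projT2 (cid h)).
Qed.

(** The selected element is a function of the predicate alone; this is what makes [rep] constant on
    each class of [e n]. *)
Lemma some_such_default d d' (P : A -> Prop) :
  (exists a, P a) -> some_such d P = some_such d' P.
Proof. by rewrite /some_such => exP; case: pselect. Qed.

End Selection.

Lemma least_from (P : nat -> Prop) n0 n : n0 <= n -> P n ->
  exists m, [/\ n0 <= m <= n, P m & forall j, n0 <= j < m -> ~ P j].
Proof.
elim/ltn_ind: n => n IH le Pn.
have [[m mn Pm]|none] := pselect (exists2 m, n0 <= m < n & P m).
  case: (IH m) => [|||k [kn Pk kmin]]; [lia|lia|done|].
  by exists k; split=> //; lia.
by exists n; split=> // [|j jn Pj]; [lia|apply: none; exists j].
Qed.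

(* Nodes carry their level and their parent; facts about them are only required
   of the legal ones, so that operations stay total. *)
Record tree := Tree {
  pos :> Type;
  dflt : pos;
  legal : pos -> Prop;
  lvl : pos -> nat;
  par : pos -> pos;
  lvl_par : forall v, lvl (par v) = (lvl v).-1;
  legal_par : forall v, legal v -> legal (par v);
  has_child : forall v, legal v ->
    exists w, [/\ legal w, lvl w = (lvl v).+1 & par w = v] }.

Arguments dflt {t}.

Section Tree.
Variable T : tree.
Implicit Types (v w : T) (x : nat -> T) (s : T -> T).

Definition child v w := [/\ legal w, lvl w = (lvl v).+1 & par w = v].

Definition play x :=
  forall n, [/\ legal (x n), lvl (x n) = n & par (x n.+1) = x n].

(* The player [b] moves at the levels of parity [b]: [false] is player I. *)
Definition strategy (b : bool) s :=
  forall v, legal v -> odd (lvl v) = b -> child v (s v).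

Definition follows (b : bool) s x := forall n, odd n = b -> x n.+1 = s (x n).

Definition anc n v := iter (lvl v - n) (@par T) v.

Lemma lvl_iter_par i v : lvl (iter i (@par T) v) = lvl v - i.
Proof. by elim: i => [|i IH] /=; rewrite ?subn0// lvl_par IH subnS. Qed.

Lemma lvl_anc n v : n <= lvl v -> lvl (anc n v) = n.
Proof. by rewrite lvl_iter_par; lia. Qed.

Lemma legal_anc n v : legal v -> legal (anc n v).
Proof. by rewrite /anc => lv; elim: (_ - n) => //= i; exact: legal_par. Qed.

Lemma anc_ge n v : lvl v <= n -> anc n v = v.
Proof. by rewrite /anc -subn_eq0 => /eqP->. Qed.

Lemma anc_par n v : n < lvl v -> anc n (par v) = anc n v.
Proof.
rewrite /anc lvl_par => nv.
by rewrite (_ : lvl v - n = ((lvl v).-1 - n).+1) ?iterSr//; lia.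
Qed.

Lemma anc_child n v w : child v w -> n <= lvl v -> anc n w = anc n v.
Proof. by move=> [_ lw E] nv; rewrite -E anc_par ?lw. Qed.

Lemma par_anc n v : n < lvl v -> par (anc n.+1 v) = anc n v.
Proof.
move=> nv; have E : lvl v - n = (lvl v - n.+1).+1 by lia.
by rewrite /anc E.
Qed.

Lemma anc_play m n x : play x -> m <= n -> anc m (x n) = x m.
Proof.
move=> px; elim: n => [|n IH] mn.
  by move: mn; rewrite leqn0 => /eqP->; rewrite anc_ge//; case: (px 0) => _ ->.
have [_ l p] := px n.+1; have [E|ne] := eqVneq m n.+1.
  by rewrite anc_ge ?l ?E.
rewrite -anc_par ?l; last by lia.
by have [_ _ ->] := px n; apply: IH; lia.
Qed.

Lemma play_child x n : play x -> child (x n) (x n.+1).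
Proof.
by move=> px; have [_ l p] := px n; have [l1 l2 _] := px n.+1; split; rewrite ?l ?l2.
Qed.

Lemma play_lvl x n : play x -> lvl (x n) = n.
Proof. by move=> px; case: (px n). Qed.

Lemma play_legal x n : play x -> legal (x n).
Proof. by move=> px; case: (px n). Qed.

Lemma playP x : (forall n, legal (x n) /\ lvl (x n) = n) ->
  (forall n, par (x n.+1) = x n) -> play x.
Proof. by move=> h1 h2 n; case: (h1 n). Qed.

(** Turns any candidate move into a strategy, so that legality of the candidate has to be checked
    only along the plays of interest. *)
Definition legalize s v := some_such (some_such v (child v)) (fun w => w = s v /\ child v w).

Lemma legalizeP s v : legal v -> child v (legalize s v).
Proof.
move=> lv; rewrite /legalize.
have [ex|nex] := pselect (exists w, w = s v /\ child v w).
  by case: (some_suchP (some_such v (child v)) ex).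
rewrite {1}/some_such; case: pselect => // _.
by apply: some_suchP; exact: has_child.
Qed.

Lemma legalizeE s v : child v (s v) -> legalize s v = s v.
Proof.
move=> c; have ex : exists w, w = s v /\ child v w by exists (s v).
by case: (some_suchP (some_such v (child v)) ex).
Qed.

(** A strategy sees only the current node; whether and where an event first occurred is read off
    from its ancestors. *)
Definition entered n0 (P : T -> Prop) v :=
  exists2 m, n0 <= m <= lvl v & P (anc m v).

Definition first_anc n0 (P : T -> Prop) v :=
  anc (some_such 0 (fun m => [/\ n0 <= m <= lvl v, P (anc m v) &
    forall j, n0 <= j < m -> ~ P (anc j v)])) v.

Lemma entered_play n0 P x n : play x ->
  entered n0 P (x n) <-> exists2 m, n0 <= m <= n & P (x m).
Proof.
move=> px; rewrite /entered (play_lvl n px).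
by split=> -[m mn]; [rewrite anc_play|exists m]; rewrite ?anc_play//; try lia;
  exists m.
Qed.

Lemma first_anc_play n0 P x m n : play x -> n0 <= m <= n -> P (x m) ->
  (forall j, n0 <= j < m -> ~ P (x j)) -> first_anc n0 P (x n) = x m.
Proof.
move=> px mn Pm mmin; rewrite /first_anc (play_lvl n px).
set Z := (fun _ => _); have : exists m, Z m.
  exists m; split=> //; first by rewrite anc_play//; lia.
  by move=> j jm; rewrite anc_play//; [exact: mmin|lia].
move/(some_suchP 0); set m' := some_such _ _.
case=> m'n; rewrite anc_play//; last by lia.
move=> Pm' m'min; have [lt|lt|->//] := ltngtP m m'.
  by case: (m'min m); [lia|rewrite anc_play//; lia].
by case: (mmin m') => //; lia.
Qed.

End Tree.

(** * Forcing a target while staying inside a set of nodes *)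

Section Reach.
Variables (T : tree) (b : bool) (Q U : T -> Prop).
Hypothesis Q_move : forall v, Q v -> odd (lvl v) = b -> exists2 w, child v w & Q w.
Implicit Types (v w : T) (x : nat -> T) (s : T -> T).

Definition confined s :=
  forall v, Q v -> odd (lvl v) = b -> child v (s v) /\ Q (s v).

Definition forces s v := forall x, play x -> x (lvl v) = v ->
  (forall n, lvl v <= n -> Q (x n)) ->
  (forall n, lvl v <= n -> odd n = b -> x n.+1 = s (x n)) ->
  exists2 n, lvl v <= n & U (x n).

(** The attractor of [U] in [Q], described by strategies instead of ordinal ranks; [reach_own] and
    [reach_opp] are its closure rules. *)
Definition reach v := exists2 s, confined s & forces s v.

Lemma confined_ex : exists s, confined s.
Proof.
exists (fun v => some_such v (fun w => child v w /\ Q w)) => v Qv ov.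
have [w vw Qw] := Q_move Qv ov.
by apply: (@some_suchP _ _ (fun w => child v w /\ Q w)); exists w.
Qed.

Definition best v := some_such id (fun s => confined s /\ (reach v -> forces s v)).

Lemma bestP v : confined (best v) /\ (reach v -> forces (best v) v).
Proof.
apply: (@some_suchP _ _ (fun s => confined s /\ (reach v -> forces s v))).
have [[s sc sf]|nr] := pselect (reach v); first by exists s.
by have [s sc] := confined_ex; exists s.
Qed.

Lemma reach_target v : U v -> reach v.
Proof.
move=> Uv; have [s sc] := confined_ex; exists s => // x _ xv _ _.
by exists (lvl v) => //; rewrite xv.
Qed.

Lemma reach_own v w : odd (lvl v) = b -> child v w -> Q w -> reach w -> reach v.
Proof.
move=> ov vw Qw [s sc sf].
exists (fun u => if `[<u = v>] then w else s u) => [u Qu ou|x px xv Qx xs].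
  by case: asboolP => [->|_] //; exact: sc.
have lw : lvl w = (lvl v).+1 by case: vw.
have xw : x (lvl v).+1 = w by rewrite xs// xv; case: asboolP.
have [|n ln|n ln on|n ln Un] := sf x px; first by rewrite lw.
- by apply: Qx; lia.
- rewrite xs//; last by lia.
  by case: asboolP => // /(congr1 (@lvl T)); rewrite play_lvl//; lia.
- by exists n => //; lia.
Qed.

Lemma reach_opp v : odd (lvl v) <> b ->
  (forall w, child v w -> Q w -> reach w) -> reach v.
Proof.
(* Glues the strategies for the various children: the ancestor one level above [lvl v] tells which
   child the opponent chose. *)
move=> ov all; exists (fun u => best (anc (lvl v).+1 u) u) => [u Qu ou|x px xv Qx xs].
  by apply: (bestP _).1.
have vw : child v (x (lvl v).+1) by rewrite -{1}xv; exact: play_child.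
have rw := all _ vw (Qx _ (leqnSn _)).
have := (bestP _).2 rw x px; rewrite play_lvl//.
case=> // [n ln|n ln on|n ln Un]; first by apply: Qx; lia.
- by rewrite xs ?(anc_play px)//; lia.
- by exists n => //; lia.
Qed.

(* Commits to the strategy chosen when [reach] is entered: following locally good
   moves alone would not guarantee progress towards the target. *)
Definition reach_strategy n0 v := best (first_anc n0 reach v) v.

Lemma reach_strategy_confined n0 : confined (reach_strategy n0).
Proof. by move=> v Qv ov; exact: (bestP _).1. Qed.

(** The strategy is followed only after [reach] has been entered, since the translations below make
    other moves before that. *)
Lemma reach_strategyP n0 n1 x : play x -> n0 <= n1 -> reach (x n1) ->
  (forall n, n0 <= n -> Q (x n)) ->
  (forall n, n0 <= n -> entered n0 reach (x n) -> odd n = b ->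
     x n.+1 = reach_strategy n0 (x n)) ->
  exists2 n, n0 <= n & U (x n).
Proof.
move=> px n01 r1 Qx xs; have [m [mn rm mmin]] := least_from (P := fun n => reach (x n)) n01 r1.
have := (bestP _).2 rm x px; rewrite play_lvl//.
case=> // [n ln|n ln on|n ln Un]; first by apply: Qx; lia.
- rewrite xs//; [|lia|by apply/(entered_play _ _ _ px); exists m; [lia|]].
  by rewrite /reach_strategy (first_anc_play px _ rm)//; lia.
- by exists n => //; lia.
Qed.

End Reach.

(** * Coverings of game trees and transfer of strategies *)

Section Covering.

Definition morphism (T' T : tree) (p : T' -> T) := forall v, legal v ->
  [/\ legal (p v), lvl (p v) = lvl v & p (par v) = par (p v)].

(* The first clause (the translated strategy at level [n] only depends on the
   original up to level [n]) is what makes transfers pass to the limit. *)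
Definition transfer k b (T' T : tree) (p : T' -> T) (phi : (T' -> T') -> T -> T) :=
  (forall s t n, (forall v, lvl v <= n -> s v = t v) ->
     forall v, lvl v <= n -> phi s v = phi t v) /\
  forall s, strategy b s ->
    [/\ strategy b (phi s),
        forall v, legal v -> lvl v < k -> odd (lvl v) = b -> phi s (p v) = p (s v)
      & forall x, play x -> follows b (phi s) x ->
          exists y, [/\ play y, follows b s y & forall n, x n = p (y n)]].

(** Martin's coverings. Strategies go down and plays go up: a play following the translated strategy
    lifts to one following the original, so that a win for the pulled-back payoff becomes a win for
    the payoff itself. *)
Definition covering k (T' T : tree) (p : T' -> T) :=
  [/\ morphism p,
      forall v w, legal v -> legal w -> lvl v <= k -> p v = p w -> v = w,
      forall w, legal w -> lvl w <= k -> exists2 v, legal v & p v = w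
    & forall b, exists phi, transfer k b p phi].

Lemma morphism_comp (T2 T1 T0 : tree) (q : T2 -> T1) (p : T1 -> T0) :
  morphism q -> morphism p -> morphism (p \o q).
Proof.
move=> mq mp v lv; have [lq eq cq] := mq v lv; have [lp ep cp] := mp _ lq.
by split=> //=; rewrite ?ep ?cq.
Qed.

Lemma morphism_play (T1 T0 : tree) (p : T1 -> T0) x :
  morphism p -> play x -> play (p \o x).
Proof.
move=> mp px; apply: playP => n /=.
  by have [? -> _] := mp _ (play_legal n px); rewrite play_lvl.
by have [_ _ <-] := mp _ (play_legal n.+1 px); case: (px n) => _ _ ->.
Qed.

Lemma covering_comp k (T2 T1 T0 : tree) (q : T2 -> T1) (p : T1 -> T0) :
  covering k q -> covering k p -> covering k (p \o q).
Proof.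
move=> [mq iq sq tq] [mp ip sp tp]; split; first exact: morphism_comp.
- move=> v w lv lw vk /= E; have [lqv eqv _] := mq v lv; have [lqw eqw _] := mq w lw.
  by apply: iq => //; apply: ip => //; rewrite eqv.
- move=> w lw wk; have [v lv vw] := sp w lw wk; have [_ ev _] := mp v lv.
  have [|u lu uv] := sq v lv; first by rewrite -ev vw.
  by exists u => //=; rewrite uv.
- move=> b; have [f [floc fs]] := tq b; have [g [gloc gs]] := tp b.
  exists (g \o f); split=> [s t n st|s ss]; first by apply: gloc => v; exact: floc.
  have [fs1 fs2 fs3] := fs s ss; have [gs1 gs2 gs3] := gs _ fs1; split=> //=.
    move=> v lv vk ov; have [lqv eqv _] := mq v lv.
    by rewrite gs2 ?eqv// fs2.
  move=> x px xf; have [y [py yf xy]] := gs3 x px xf.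
  have [z [pz zf yz]] := fs3 y py yf; exists z; split=> // n.
  by rewrite xy yz.
Qed.

End Covering.

(** * Limits of towers of coverings *)

Section Limit.
Variables (k : nat) (T : nat -> tree) (p : forall i, T i.+1 -> T i).
Hypothesis covp : forall i, covering (k + i) (p (i := i)).

Let V := forall i, T i.

Definition thread (v : V) := forall i, legal (v i) /\ p (v i.+1) = v i.

Lemma thread_lvl (v : V) i : thread v -> lvl (v i) = lvl (v 0).
Proof.
move=> tv; elim: i => // i <-; have [_ <-] := tv i.
by have [mp _ _ _] := covp i; have [_ -> _] := mp _ (tv i.+1).1.
Qed.

(** Coordinates below [i] are images of the [i]-th one; those above agree because the coverings
    above [i] are injective on these levels. *)
Lemma thread_inj (v w : V) i : thread v -> thread w -> lvl (v 0) <= k + i ->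
  v i = w i -> v = w.
Proof.
move=> tv tw li vw.
have up n : i <= n -> v n = w n.
  elim: n => [|n IH] ni; first by move: ni vw; rewrite leqn0 => /eqP->.
  have [E|ne] := eqVneq i n.+1; first by move: vw; rewrite E.
  have [_ inj _ _] := covp n; apply: inj => //; [exact: (tv _).1|exact: (tw _).1| |].
    by rewrite thread_lvl//; lia.
  by rewrite (tv n).2 (tw n).2 IH//; lia.
have down d j : v (d + j) = w (d + j) -> v j = w j.
  by elim: d => //= d IH E; apply: IH; rewrite -(tv _).2 -(tw _).2; congr p.
by apply: functional_extensionality_dep => j; apply: (down i); apply: up; lia.
Qed.

Lemma thread_lift i (v : T i) : legal v -> lvl v <= k + i ->
  exists2 w, thread w & w i = v.
Proof.
move=> lv vi.
have down m (u : T m) : legal u -> exists w : V, [/\ w m = u,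
    forall j, j <= m -> legal (w j) & forall j, j < m -> p (w j.+1) = w j].
  elim: m u => [|m IH] u lu.
    exists (@dfwith nat T (fun j => dflt) 0 u); rewrite dfwith_in; split=> //.
    by move=> j; rewrite leqn0 => /eqP->; rewrite dfwith_in.
  have [mp _ _ _] := covp m; have [lpu _ _] := mp u lu.
  have [w [wm wl wp]] := IH _ lpu.
  exists (@dfwith nat T w m.+1 u); rewrite dfwith_in; split=> // j jm.
    have [->|ne] := eqVneq j m.+1; first by rewrite dfwith_in.
    by rewrite dfwith_out 1?eq_sym//; apply: wl; lia.
  rewrite [dfwith _ _ j]dfwith_out; last by lia.
  have [->|ne] := eqVneq j m; first by rewrite dfwith_in.
  by rewrite dfwith_out; [apply: wp|]; lia.
have [D [Di Dl Dp]] := down i v lv.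
(* Follows the images of [v] down to [T 0] and continues above [i] by chosen preimages, which exist
   since these coverings are onto at level [lvl v]. *)
pose W := fix W j : T j := match j with
  | 0 => D 0
  | j.+1 => if j < i then D j.+1 else some_such dflt (fun u => legal u /\ p u = W j)
  end.
have WD j : j <= i -> W j = D j by case: j => // j /= ->.
have Wi : W i = v by rewrite WD.
have Wl j : i <= j -> legal (W j) /\ lvl (W j) = lvl v.
  have Wli : legal (W i) /\ lvl (W i) = lvl v by rewrite Wi.
  elim: j => [|j IH] ij.
    by move: ij; rewrite leqn0 => /eqP E; case: _ / E.
  have [E|ne] := eqVneq i j.+1; first by case: _ / E.
  have [|lW eW] := IH; first by lia.
  have [mp _ surj _] := covp j; have [|u lu up] := surj (W j) lW; first by rewrite eW; lia.
  have /= -> : (j < i) = false by lia.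
  have /(some_suchP dflt) : exists u, legal u /\ p u = W j by exists u.
  set z := some_such _ _ => -[lz pz]; split=> //.
  by have [_ <- _] := mp z lz; rewrite pz.
exists W => // j; split.
  by have [ji|ij] := leqP j i; [rewrite WD//; exact: Dl|apply: (Wl _ _).1; lia].
have /= [ji|ij] := ltnP j i; first by rewrite Dp// WD//; lia.
have [lW eW] := Wl j ij.
have [mp _ surj _] := covp j; have [|u lu up] := surj (W j) lW; first by rewrite eW; lia.
have ex : exists u, legal u /\ p u = W j by exists u.
by case: (some_suchP dflt ex).
Qed.

Lemma thread_par (v : V) : thread v -> thread (fun i => par (v i)).
Proof.
move=> tv i; split; first by apply: legal_par; exact: (tv i).1.
by have [mp _ _ _] := covp i; have [_ _ ->] := mp _ (tv i.+1).1; rewrite (tv i).2.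
Qed.

Lemma thread_child (v : V) : thread v ->
  exists w : V, [/\ thread w, lvl (w 0) = (lvl (v 0)).+1 & (fun i => par (w i)) = v].
Proof.
move=> tv; set i := (lvl (v 0)).+1.
have [u [lu eu pu]] := has_child (tv i).1.
have [|w tw wu] := thread_lift lu; first by rewrite eu thread_lvl// /i; lia.
exists w; split=> //; first by rewrite -(thread_lvl i tw) wu eu thread_lvl.
apply: (thread_inj (i := i)) => //; first exact: thread_par.
  by rewrite -(thread_lvl i (thread_par tw)) wu pu thread_lvl// /i; lia.
by rewrite wu pu.
Qed.

Definition limit : tree := @Tree V (fun i => dflt) thread (fun v => lvl (v 0))
  (fun v i => par (v i)) (fun v => lvl_par (v 0)) thread_par thread_child.

Definition proj i (v : limit) : T i := v i.

Lemma proj_morphism i : morphism (proj i).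
Proof.
by move=> v tv; split=> //; [exact: (tv i).1|rewrite /proj thread_lvl].
Qed.

Section Transfer.
Variables (b : bool) (phi : forall i, (T i.+1 -> T i.+1) -> T i -> T i).
Hypothesis phiP : forall i, transfer (k + i) b (p (i := i)) (phi (i := i)).

(* Makes agreement of strategies on the relevant nodes agreement everywhere. *)
Definition normalize (S : tree) (s : S -> S) v :=
  if `[<legal v /\ odd (lvl v) = b>] then s v else v.

(** Up to level [k + i] the tree [T i] is a copy of the limit, so there the move of [s] can be read
    off; higher up an arbitrary child is a placeholder. *)
Definition stage0 (s : limit -> limit) i (v : T i) : T i :=
  if lvl v < k + i then s (some_such (dflt : limit) (fun w => thread w /\ w i = v)) i
  else some_such v (child v).

(* [stage s d i] pushes [s] down from the tree [T (i + d)], whose levels up to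
   [k + i + d] are those of the limit; it is correct below that level. *)
Fixpoint stage (s : limit -> limit) d i : T i -> T i :=
  match d with
  | 0 => normalize (@stage0 s i)
  | d.+1 => normalize (phi (stage s d (i := i.+1)))
  end.

(** Depth [(lvl v).+1] is always enough, as [stage s d] is final below level [k + i + d]; the
    successor covers [k + i = 0] and lets one [phi] be unfolded. *)
Definition limit_strategy s i (v : T i) := stage s (lvl v).+1 v.

Lemma through_thread i (w : V) : thread w -> lvl (w 0) <= k + i ->
  some_such (dflt : limit) (fun w' => thread w' /\ w' i = w i) = w.
Proof.
move=> tw wi; have /(some_suchP (dflt : limit)) : exists w', thread w' /\ w' i = w i by exists w.
by case=> t e; apply: (thread_inj (i := i)) => //; rewrite -(thread_lvl i t) e thread_lvl.
Qed.

Lemma stage0E s i (w : V) : thread w -> lvl (w 0) < k + i ->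
  stage0 s (w i) = s w i.
Proof.
by move=> tw wi; rewrite /stage0 thread_lvl// wi through_thread// ltnW.
Qed.

Section Strategy.
Variable s : limit -> limit.
Hypothesis ss : strategy b s.

Lemma normalizeE (S : tree) (t : S -> S) v : legal v -> odd (lvl v) = b ->
  normalize t v = t v.
Proof. by move=> lv ov; rewrite /normalize; case: asboolP => // -[]. Qed.

Lemma normalize_strategy (S : tree) (t : S -> S) :
  (forall v, legal v -> odd (lvl v) = b -> child v (t v)) -> strategy b (normalize t).
Proof. by move=> h v lv ov; rewrite normalizeE//; exact: h. Qed.

Lemma stage_strategy d i : strategy b (stage s d (i := i)).
Proof.
elim: d i => [|d IH] i /=; apply: normalize_strategy => v lv ov; last first.
  by have [sp _ _] := (phiP i).2 _ (@IH i.+1); exact: sp.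
have [vi|iv] := ltnP (lvl v) (k + i); last first.
  by rewrite /stage0 ltnNge iv /=; apply: some_suchP; exact: has_child.
have [w tw wv] := thread_lift lv (ltnW vi).
have lw : lvl (w 0) = lvl v by rewrite -wv thread_lvl.
rewrite -wv stage0E ?lw//; have [|ts ls ps] := ss (v := w) tw.
  by rewrite /= lw.
split; first exact: (ts i).1.
  by rewrite (thread_lvl i ts) (thread_lvl i tw).
by rewrite -[in RHS]ps.
Qed.

(** The base case is the agreement of [phi s] with [s] below level [k + i]; the induction step is
    the locality of [phi]. *)
Lemma stage_agree d i (v : T i) : lvl v < k + i + d -> stage s d v = stage s d.+1 v.
Proof.
elim: d i v => [|d IH] i v vi /=; last first.
  rewrite /normalize; case: asboolP => // _.
  by apply: ((phiP i).1 _ _ (lvl v)) => // u uv; apply: IH; lia.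
rewrite /normalize; case: asboolP => // -[lv ov].
have [|w tw wv] := thread_lift lv; first by lia.
have lw : lvl (w 0) = lvl v by rewrite -wv thread_lvl.
have [_ ag _] := (phiP i).2 _ (@stage_strategy 0 i.+1).
rewrite -wv stage0E//; last by rewrite lw; lia.
rewrite -(tw i).2 ag; [|exact: (tw _).1|rewrite thread_lvl// lw; lia|by rewrite thread_lvl// lw].
rewrite /= normalizeE; [|exact: (tw _).1|by rewrite thread_lvl// lw].
rewrite stage0E//; last by rewrite lw; lia.
have [|ts _ _] := ss (v := w) tw; first by rewrite /= lw.
by rewrite (ts i).2.
Qed.

Lemma stage_stable d e i (v : T i) : lvl v < k + i + d ->
  stage s d v = stage s (e + d) v.
Proof.
move=> vi; elim: e => // e ->; apply: stage_agree; lia.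
Qed.

Lemma limit_strategyE d i (v : T i) : lvl v < k + i + d ->
  limit_strategy s v = stage s d v.
Proof.
move=> vi; rewrite /limit_strategy (@stage_stable _ d); last by lia.
by rewrite (@stage_stable d (lvl v).+1) // addnC.
Qed.

Lemma limit_strategy_strategy i : strategy b (limit_strategy s (i := i)).
Proof. by move=> v lv ov; exact: stage_strategy. Qed.

Lemma limit_strategy_phi i (v : T i) : legal v -> odd (lvl v) = b ->
  limit_strategy s v = phi (limit_strategy s (i := i.+1)) v.
Proof.
move=> lv ov; rewrite /limit_strategy /= normalizeE//.
apply: ((phiP i).1 _ _ (lvl v)) => // u uv.
by rewrite -[RHS]/(limit_strategy s u) (@limit_strategyE (lvl v))//; lia.
Qed.

Lemma limit_strategy_proj i (w : limit) : legal w -> lvl w < k + i ->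
  odd (lvl w) = b -> limit_strategy s (w i) = s w i.
Proof.
move=> tw wi ow; have lw : lvl (w i) = lvl (w 0) by rewrite thread_lvl.
rewrite (@limit_strategyE 0); last by rewrite lw addn0.
by rewrite /= normalizeE ?stage0E ?lw//; exact: (tw i).1.
Qed.

Lemma limit_lift (x : nat -> T 0) : play x -> follows b (limit_strategy s (i := 0)) x ->
  exists y : nat -> limit, [/\ play y, follows b s y & forall n, x n = proj 0 (y n)].
Proof.
move=> px xs.
pose good i := {x : nat -> T i | play x /\ follows b (limit_strategy s (i := i)) x}.
have step i (z : good i) : {z' : good i.+1 | forall n, sval z n = p (sval z' n)}.
  apply: cid; case: z => z [pz zs] /=.
  have [_ _ lift] := (phiP i).2 _ (@limit_strategy_strategy i.+1).
  have [|z' [pz' zs' zz']] := lift z pz; last by exists (exist _ z' (conj pz' zs')).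
  move=> n on; rewrite zs// limit_strategy_phi//; first exact: play_legal.
  by rewrite play_lvl.
(* Lifts the play through one covering after another; the coherent plays obtained form the threads
   of [y]. *)
pose X := fix X i : good i := match i with
  | 0 => exist _ x (conj px xs) | i.+1 => sval (step i (X i)) end.
pose y n : limit := fun i => sval (X i) n.
have yt n : thread (y n).
  move=> i; split; first by apply: play_legal; case: (svalP (X i)).
  by rewrite -(svalP (step i (X i)) n).
exists y; split=> //.
  apply: playP => n; first by split; [exact: yt|rewrite /= play_lvl].
  apply: functional_extensionality_dep => i /=.
  by have [pXi _] := svalP (X i); case: (pXi n).
move=> n on; have ln : lvl (y n) = n by rewrite /= play_lvl.
have [|ts ls _] := ss (yt n); first by rewrite ln.
have ln1 : lvl (y n.+1) = n.+1 by rewrite /= play_lvl.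
(* Coordinate [n.+1] determines a thread of level [n.+1], and at level [n] of that tree the limit
   strategy is still [s] itself. *)
apply: (thread_inj (i := n.+1)) => //; first by rewrite -[lvl _]/(lvl (y n.+1)) ln1; lia.
have [pX Xs] := svalP (X n.+1).
rewrite /y Xs// -[sval _ n]/(y n n.+1).
by apply: limit_strategy_proj => //; [exact: yt|rewrite ln; lia|rewrite ln].
Qed.

End Strategy.

Lemma stage_local s t n d i (v : T i) :
  (forall v, lvl v <= n -> s v = t v) -> lvl v <= n -> stage s d v = stage t d v.
Proof.
move=> st; elim: d i v => [|d IH] i v vn /=; rewrite /normalize; case: asboolP => //; last first.
  by move=> _; apply: ((phiP i).1 _ _ n) => // u un; apply: IH.
move=> -[lv ov]; rewrite /stage0; case: ifP => // vi.
have [w tw wv] := thread_lift lv (ltnW vi).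
have lw : lvl (w 0) = lvl v by rewrite -wv thread_lvl.
rewrite -wv through_thread//; last by rewrite lw ltnW.
by rewrite st//= lw.
Qed.

End Transfer.

Lemma limit_covering : covering k (proj 0).
Proof.
split; first exact: proj_morphism.
- by move=> v w tv tw vk; apply: thread_inj => //; rewrite addn0.
- by move=> w lw wk; have [|v tv vw] := thread_lift lw; [rewrite addn0|exists v].
move=> b; have h i : {phi | transfer (k + i) b (p (i := i)) phi}.
  by apply: cid; have [_ _ _] := covp i.
exists (fun s => limit_strategy b (fun i => sval (h i)) s (i := 0)).
have hP i := svalP (h i).
split=> [s t n st v vn|s ss]; first exact: (stage_local hP _ st vn).
split; first exact: limit_strategy_strategy.
  by move=> v lv vk ov; apply: limit_strategy_proj => //; rewrite addn0.
exact: limit_lift.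
Qed.

End Limit.

(** * Unfolding an open set *)

Section Unfolding.
Variables (T : tree) (N : nat) (E : T -> Prop).
Hypothesis E_child : forall v w, child v w -> E v -> E w.
Implicit Types (v w x u : T) (a Q s : T -> Prop).

Definition quasi (b : bool) (c : T) Q s :=
  [/\ s c,
      forall v, s v -> [/\ Q v, lvl c <= lvl v & anc (lvl c) v = c],
      forall v, s v -> lvl c < lvl v -> s (par v),
      forall v w, s v -> odd (lvl v) <> b -> child v w -> Q w -> s w
    & forall v, s v -> odd (lvl v) = b -> exists2 w, child v w & s w].

(* Martin's auxiliary game for the open set of plays meeting [E]. At level [N],
   player I also plays a quasistrategy [a] for himself. Then II either plays
   [inl u], a node of [a] in [E] through which the play must go, or [inr s], a
   quasistrategy inside [a] that avoids [E] and in which the play must remain. *)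
Definition upos := (T * (T -> Prop) * (T + (T -> Prop)))%type.

(** Fixed blanks before the announcements keep [ubase] injective up to level [N]. *)
Definition blank_set : T -> Prop := fun=> False.
Definition blank_option : T + (T -> Prop) := inr (fun=> False).

Definition ulegal (z : upos) := let: (x, a, o) := z in
  [/\ legal x, lvl x <= N -> a = blank_set, lvl x <= N.+1 -> o = blank_option,
      N < lvl x -> quasi false (anc N.+1 x) (@legal T) a
    & N.+1 < lvl x -> match o with
      | inl u => [/\ a u, E u, N.+1 < lvl u & anc (lvl x) u = anc (lvl u) x]
        (* the last equation says that [u] and [x] are comparable *)
      | inr s => [/\ quasi true (anc N.+2 x) a s, forall v, s v -> ~ E v & s x]
      end].

Definition ulvl (z : upos) := lvl z.1.1.

Definition upar (z : upos) : upos := let: (x, a, o) := z in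
  (par x, if lvl x <= N.+1 then blank_set else a, if lvl x <= N.+2 then blank_option else o).

Lemma ulvl_par z : ulvl (upar z) = (ulvl z).-1.
Proof. by case: z => -[x a] o; rewrite /ulvl /= lvl_par. Qed.

Lemma ulegal_par z : ulegal z -> ulegal (upar z).
Proof.
case: z => -[x a] o [lx xa xo qa qo]; rewrite /= lvl_par; split.
- exact: legal_par.
- by move=> h; case: ifP => //; lia.
- by move=> h; case: ifP => //; lia.
- move=> h; rewrite anc_par; last by lia.
  by case: ifP => [|_]; [lia|apply: qa; lia].
- move=> h; case: ifP => [|_]; first by lia.
  case: ifP => [|_]; first by lia.
  have /qo : N.+1 < lvl x by lia.
  case: o {xo qo} => [u [au Eu lu xu]|s [qS nE Sx]]; split=> //.
  + have [xlu|ulx] := leqP (lvl x) (lvl u).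
      rewrite [RHS]anc_ge; last by rewrite lvl_par; lia.
      have xE : anc (lvl x) u = x by rewrite xu anc_ge.
      rewrite -(@par_anc _ (lvl x).-1) ?prednK ?xE//; lia.
    by rewrite anc_par// -xu !anc_ge//; lia.
  + by rewrite anc_par//; lia.
  + have [_ _ cl _ _] := qS; apply: cl => //.
    by rewrite lvl_anc; lia.
Qed.

Lemma cone_quasi b c Q : Q c -> (forall v, Q v -> legal v) ->
  (forall v, Q v -> lvl c < lvl v -> Q (par v)) ->
  (forall v, Q v -> odd (lvl v) = b -> exists2 w, child v w & Q w) ->
  quasi b c Q (fun v => [/\ Q v, lvl c <= lvl v & anc (lvl c) v = c]).
Proof.
move=> Qc Ql Qp Qm; split=> //.
- by split=> //; rewrite anc_ge.
- move=> v [Qv cv av] lv; split; [exact: Qp| |by rewrite anc_par].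
  by rewrite lvl_par; lia.
- move=> v w [Qv cv av] _ vw Qw; have [_ lw _] := vw.
  by split=> //; [lia|rewrite (anc_child vw)].
- move=> v [Qv cv av] ov; have [w vw Qw] := Qm _ Qv ov; have [_ lw _] := vw.
  by exists w => //; split=> //; [lia|rewrite (anc_child vw)].
Qed.

Lemma quasi_legal b c a v : quasi b c (@legal T) a -> a v -> legal v.
Proof. by move=> [_ h _ _ _] /h[]. Qed.

Lemma quasi_child c a v : quasi false c (@legal T) a -> a v -> exists2 w, child v w & a w.
Proof.
move=> qa av; have [_ _ _ opp own] := qa.
case: (boolP (odd (lvl v))) => [ov|/negbTE ov]; last exact: own.
have lv := quasi_legal qa av; have [w vw] := has_child lv.
by exists w => //; apply: (opp v) => //; [rewrite ov|case: vw].
Qed.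

(** At level [N], I can announce the whole cone above his move. At the next level, II announces a
    node of [E] in [a] above his move if there is one; otherwise the part of [a] above this move
    avoids [E] and can itself be announced. *)
Lemma ulegal_child z : ulegal z ->
  exists w : upos, [/\ ulegal w, ulvl w = (ulvl z).+1 & upar w = z].
Proof.
case: z => -[x a] o lz; have [lx xa xo qa qo] := lz; rewrite /ulvl /=.
have [xN|Nx] := ltnP (lvl x) N.
  have [w [lw ew pw]] := has_child lx; exists (w, blank_set, blank_option).
  rewrite /= ew pw xa ?xo; try lia.
  rewrite ifT; last by lia.
  rewrite ifT; last by lia.
  by split=> //; split=> //; lia.
have [xN|Nx'] := leqP (lvl x) N.
  have {xN Nx}xN : lvl x = N by lia.
  have [w [lw ew pw]] := has_child lx.
  exists (w, (fun v => [/\ legal v, lvl w <= lvl v & anc (lvl w) v = w]), blank_option).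
  rewrite /= ew pw xN xa ?xo; try lia.
  rewrite ifT// ifT//; split=> //; split=> //; try lia.
  move=> _; rewrite anc_ge; last by lia.
  rewrite -xN -ew; apply: cone_quasi => //; first by move=> v lv _; exact: legal_par.
  by move=> v lv _; have [w' [? ? ?]] := has_child lv; exists w' => //; split.
have qa' := qa Nx'; have [ac al ap aopp aown] := qa'.
have [xN|Nx''] := leqP (lvl x) N.+1.
  have {xN Nx'}xN : lvl x = N.+1 by lia.
  have ax : a x by move: ac; rewrite anc_ge// xN.
  have [w vw aw] := quasi_child qa' ax; have [lw ew pw] := vw.
  have qw o' : match o' with
      | inl u => [/\ a u, E u, N.+1 < lvl u & anc (lvl w) u = anc (lvl u) w]
      | inr s => [/\ quasi true (anc N.+2 w) a s, forall v, s v -> ~ E v & s w]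
      end -> exists w' : upos, [/\ ulegal w', lvl w'.1.1 = (lvl x).+1 & upar w' = (x, a, o)].
    move=> h; exists (w, a, o'); rewrite /= ew pw xN xo; last by lia.
    rewrite ifF; last by lia.
    rewrite ifT//; split=> //; split=> //; try lia.
      by rewrite (anc_child vw) ?xN.
    by move=> _; move: h; rewrite ew xN.
  have [[u [au Eu wu xu]]|none] := pselect (exists u, [/\ a u, E u, lvl w <= lvl u & anc (lvl w) u = w]).
    by apply: (qw (inl u)); split=> //; [lia|rewrite xu anc_ge].
  apply: (qw (inr (fun v => [/\ a v, lvl w <= lvl v & anc (lvl w) v = w]))); split.
  - rewrite anc_ge; last by lia.
    apply: cone_quasi => // [v|v av wv|v av _]; first exact: quasi_legal qa'.
      by apply: ap => //; rewrite lvl_anc; lia.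
    exact: quasi_child qa' av.
  - by move=> v [av wv e] Ev; apply: none; exists v.
  - by split=> //; rewrite anc_ge.
have {}qo := qo Nx''.
have ok w : child x w ->
    match o with
      | inl u => [/\ a u, E u, N.+1 < lvl u & anc (lvl w) u = anc (lvl u) w]
      | inr s => [/\ quasi true (anc N.+2 w) a s, forall v, s v -> ~ E v & s w]
      end -> exists w' : upos, [/\ ulegal w', lvl w'.1.1 = (lvl x).+1 & upar w' = (x, a, o)].
  move=> vw h; have [lw ew pw] := vw; exists (w, a, o); rewrite /= ew pw.
  rewrite ifF; last by lia.
  rewrite ifF; last by lia.
  split=> //; split=> //; try lia.
    by rewrite (anc_child vw).
  by move=> _; rewrite -ew.
case: o lz xo qo ok => [u|s] lz xo => [[au Eu lu xu]|[qS nE Sx]] ok.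
  have [xu'|ux] := ltnP (lvl x) (lvl u).
    have xE : anc (lvl x) u = x by rewrite xu anc_ge// ltnW.
    apply: (ok (anc (lvl x).+1 u)).
      split; [by apply/legal_anc; exact: quasi_legal qa' au|by rewrite lvl_anc|].
      by rewrite par_anc.
    by split=> //; rewrite lvl_anc// [RHS]anc_ge ?lvl_anc.
  have [w vw] := has_child lx; apply: (ok w vw); split=> //.
  have [_ ew _] := vw.
  by rewrite (anc_child vw)// -xu !anc_ge//; lia.
have [_ Sa _ Sopp Sown] := qS.
have [w vw Sw] : exists2 w, child x w & s w.
  have [ax _ _] := Sa _ Sx.
  case: (boolP (odd (lvl x))) => [|/negbTE] ov; first exact: Sown.
  have [w vw aw] := quasi_child qa' ax; exists w => //.
  by apply: (Sopp x) => //; rewrite ov.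
by apply: (ok w vw); split=> //; rewrite (anc_child vw).
Qed.

Definition unfolding : tree := @Tree upos (dflt, blank_set, blank_option) ulegal ulvl upar
  ulvl_par ulegal_par ulegal_child.

Definition ubase (z : unfolding) : T := z.1.1.

Lemma ubase_morphism : morphism ubase.
Proof. by case=> -[x a] o [lx _ _ _ _]; split. Qed.

Lemma ubase_inj (v w : unfolding) : legal v -> legal w -> lvl v <= N ->
  ubase v = ubase w -> v = w.
Proof.
case: v w => -[x a] o [[y a'] o'] [_ xa xo _ _] [_ ya yo _ _]; rewrite /= /ulvl /ubase /=.
by move=> xN xy; move: ya yo; rewrite -xy => ya yo; rewrite xa ?xo ?ya ?yo//; lia.
Qed.

Lemma ubase_surj x : legal x -> lvl x <= N -> legal ((x, blank_set, blank_option) : unfolding).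
Proof. by move=> lx xN; split=> //; lia. Qed.

Definition uat a o x : unfolding :=
  (x, if lvl x <= N then blank_set else a, if lvl x <= N.+1 then blank_option else o).

Lemma uat_play a o (x : nat -> T) : play x -> (forall n, ulegal (uat a o (x n))) ->
  play (uat a o \o x : nat -> unfolding).
Proof.
move=> px lx; apply: playP => n; first by split; [exact: lx|rewrite /= /ulvl /= play_lvl].
have [lxn en pn] := px n; have [_ en1 _] := px n.+1.
rewrite /= /uat en en1 pn; congr (_, _, _).
  have [h|h] := leqP n N; first by rewrite ifT.
  by rewrite ifF ?ifF//; lia.
have [h|h] := leqP n N.+1; first by rewrite ifT.
by rewrite ifF ?ifF//; lia.
Qed.

Lemma uat_child a o v (z : unfolding) : child (uat a o v : unfolding) z ->
  N.+1 < lvl v -> z = (ubase z, a, o).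
Proof.
case: z => -[y a'] o' [lz ez pz] Nv; move: ez pz; rewrite /= /ulvl /= => ez [py].
by rewrite ez; do !case: ifP => ?; try lia; move=> -> ->.
Qed.

Lemma uat_follow_exit a u v (z : unfolding) : child (uat a (inl u) v : unfolding) z ->
  N.+1 < lvl v < lvl u -> ubase z = anc (lvl v).+1 u.
Proof.
move=> vz vu; have zE := uat_child vz (proj1 (andP vu)).
have [lz ez _] := vz; move: lz ez; rewrite zE; set y := ubase z.
rewrite /= /ulvl /= => -[_ _ _ _] + ey; rewrite ey => -[|_ _ _ ->]; first by lia.
by rewrite anc_ge// ey; lia.
Qed.

Lemma uat_follow_stay a s v (z : unfolding) : child (uat a (inr s) v : unfolding) z ->
  N.+1 < lvl v -> s (ubase z).
Proof.
move=> vz vu; have zE := uat_child vz vu.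
have [lz ez _] := vz; move: lz ez; rewrite zE; set y := ubase z.
by rewrite /= /ulvl /= => -[_ _ _ _] + ey; rewrite ey => -[|_ _]; first by lia.
Qed.

Lemma ubase_clopen (x : nat -> unfolding) : play x ->
  (exists n, E (ubase (x n))) <-> (if (x N.+2).2 is inl _ then True else False).
Proof.
move=> px; pose a := (x N.+2).1.2; pose o := (x N.+2).2; pose y n := ubase (x n).
have py : play y by exact: morphism_play ubase_morphism px.
have xE n : N.+1 < n -> x n = (y n, a, o).
  elim: n => // n IH Nn; have [E2|ne] := eqVneq n.+1 N.+2.
    by rewrite /y E2 /a /o /ubase; case: (x N.+2) => -[].
  have vz := play_child n px; rewrite [x n]IH in vz; last by lia.
  rewrite /y {1}(_ : x n.+1 = (ubase (x n.+1), a, o))//.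
  have yE : (y n, a, o) = uat a o (y n).
    by rewrite /uat play_lvl//; do !case: ifP => //; lia.
  by apply: (uat_child (v := y n)); [rewrite -yE|rewrite play_lvl//; lia].
rewrite -/o; case oE : o => [u|s]; split=> //.
- move=> _; have Nu : N.+1 < lvl u.
    have := play_legal N.+2 px; rewrite xE// oE => -[_ _ _ _].
    by rewrite play_lvl// => -[].
  exists (lvl u); have := play_legal (lvl u) px; rewrite xE// oE => -[_ _ _ _].
  rewrite play_lvl// => -[]// au Eu _; rewrite anc_ge// anc_ge ?play_lvl// => <-.
  exact: Eu.
(* By [E_child] a play that meets [E] stays in it, also beyond level [N.+1], where an announced
   quasistrategy excludes it. *)
- move=> [n En].
  have Em m : E (y (m + n)).
    by elim: m => // m; apply: E_child; exact: play_child.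
  have := play_legal (N.+2 + n) px; rewrite xE ?oE; last by lia.
  move=> [_ _ _ _]; rewrite play_lvl// => -[]; first by lia.
  by move=> _ /(_ _ _ (Em N.+2)).
Qed.

Definition safe b Q U c v :=
  [/\ Q v, lvl c <= lvl v, anc (lvl c) v = c & ~ entered (lvl c) (reach b Q U) v].

(** Outside the attractor, no move of [b] enters it, by [reach_own], and the opponent has a move
    that stays out, by [reach_opp]. *)
Lemma safe_quasi b Q U c :
  (forall v, Q v -> odd (lvl v) = b -> exists2 w, child v w & Q w) ->
  (forall v, Q v -> lvl c < lvl v -> Q (par v)) ->
  Q c -> ~ reach b Q U c ->
  quasi (~~ b) c Q (safe b Q U c) /\ forall v, safe b Q U c v -> ~ U v.
Proof.
move=> Qm Qp Qc nc.
have notreach v : safe b Q U c v -> ~ reach b Q U v.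
  by move=> [_ cv _ ne] r; apply: ne; exists (lvl v); rewrite ?cv ?leqnn ?anc_ge.
have extend v w : safe b Q U c v -> child v w -> Q w -> ~ reach b Q U w -> safe b Q U c w.
  move=> [Qv cv av ne] vw Qw nr; have [_ lw _] := vw.
  split=> //; [lia|by rewrite (anc_child vw)|] => -[m mw].
  have [mv|vm] := leqP m (lvl v); last by rewrite anc_ge//; lia.
  by rewrite (anc_child vw)// => r; apply: ne; exists m => //; lia.
split; last by move=> v sv Uv; apply: (notreach v sv); exact: reach_target.
split.
- split=> //; first by rewrite anc_ge.
  by move=> [m mc]; rewrite anc_ge//; lia.
- by move=> v [].
- move=> v [Qv cv av ne] lv; split; [exact: Qp|by rewrite lvl_par; lia|by rewrite anc_par|].
  move=> [m]; rewrite lvl_par => mv; rewrite anc_par; last by lia.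
  by move=> r; apply: ne; exists m => //; lia.
- move=> v w sv ov vw Qw; apply: (extend v w) => // r; apply: (notreach v sv).
  by apply: (reach_own Qm _ vw) => //; move: ov; case: odd (b) => -[].
- move=> v sv ov; apply: contrapT => none; apply: (notreach v sv).
  apply: reach_opp => //; first by rewrite ov; case: (b).
  move=> w vw Qw; apply: contrapT => nr; apply: none; exists w => //.
  exact: (extend v w).
Qed.

Lemma anc_play_sym (x : nat -> T) i j : play x -> anc i (x j) = anc j (x i).
Proof.
move=> px; have [ij|ji] := leqP i j.
  by rewrite anc_play// anc_ge ?play_lvl.
by rewrite [RHS]anc_play 1?ltnW// anc_ge ?play_lvl// ltnW.
Qed.

Lemma uat_legal a o (x : nat -> T) n : play x -> quasi false (x N.+1) (@legal T) a ->
  (N.+1 < n -> match o with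
     | inl u => [/\ a u, E u, N.+1 < lvl u & anc n u = anc (lvl u) (x n)]
     | inr s => [/\ quasi true (x N.+2) a s, forall v, s v -> ~ E v & s (x n)]
     end) -> ulegal (uat a o (x n)).
Proof.
move=> px qa qo; rewrite /uat /= play_lvl//; split=> [|h|h|h|h].
- exact: play_legal.
- by rewrite ifT.
- by rewrite ifT.
- by rewrite ifF ?anc_play//; lia.
- have -> : (n <= N.+1) = false by lia.
  have -> : (n <= N) = false by lia.
  by rewrite anc_play//; exact: qo.
Qed.

Lemma uat_low a o x : lvl x <= N -> uat a o x = (x, blank_set, blank_option).
Proof. by move=> xN; rewrite /uat !ifT//; lia. Qed.

Lemma uat_high a o x : N.+1 < lvl x -> uat a o x = (x, a, o).
Proof. by move=> xN; rewrite /uat !ifF//; lia. Qed.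

Lemma uat_mid a o x : lvl x = N.+1 -> uat a o x = (x, a, blank_option).
Proof. by move=> xN; rewrite /uat ifF ?ifT//; lia. Qed.

(** Shared by both translations: with the announcements [a] and [o] fixed, the lift can only be
    [uat a o \o x], and it is compared with [t] level by level. For a given [b] only one of the
    hypotheses on announcements is not vacuous. *)
Lemma unfolding_lift b (t : unfolding -> unfolding) a o (x : nat -> T) :
  strategy b t -> play x -> (forall n, ulegal (uat a o (x n))) ->
  (forall n, odd n = b -> n <= N -> x n.+1 = ubase (t (x n, blank_set, blank_option))) ->
  (odd N = b -> (t (x N, blank_set, blank_option)).1.2 = a) ->
  (odd N.+1 = b -> x N.+2 = ubase (t (x N.+1, a, blank_option)) /\ (t (x N.+1, a, blank_option)).2 = o) ->
  (forall n, odd n = b -> N.+1 < n -> x n.+1 = ubase (t (x n, a, o))) ->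
  exists y : nat -> unfolding,
    [/\ play y, follows b t y & forall n, x n = ubase (y n)].
Proof.
move=> st px lx low atN atN1 high; exists (uat a o \o x); split=> //; first exact: uat_play.
move=> n on /=; have lz := lx n; have en := play_lvl n px; have en1 := play_lvl n.+1 px.
have zc : child (uat a o (x n) : unfolding) (t (uat a o (x n))).
  by apply: st => //; rewrite /= /ulvl /= en.
have [lt et pt] := zc; move: et; rewrite /= /ulvl /= en => et.
have [nN|Nn] := leqP n N.
  rewrite uat_low ?en// in lt et *; have e := low n on nN.
  have [nN'|Nn'] := ltnP n N.
    rewrite uat_low ?en1//; apply: ubase_inj => //.
      by apply: ubase_surj; [exact: play_legal|rewrite en1].
    by rewrite /= /ulvl /= en1.
  have nE : n = N by lia.
  rewrite uat_mid ?en1 ?nE//; move: e atN lt et; rewrite nE; case: (t _) => -[y a'] o' /=.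
  rewrite /ubase /= => -> h; rewrite -nE => [-[_ _ yo _ _] ey].
  by rewrite h -?nE// yo// ey nE.
have [nN1|N1n] := leqP n N.+1.
  have nE : n = N.+1 by lia.
  have [|e1 e2] := atN1; first by rewrite -nE.
  rewrite uat_mid ?en// nE in pt *; rewrite uat_high ?play_lvl//.
  move: e1 e2 pt et; rewrite uat_mid ?en// nE; case: (t _) => -[y a'] o' /=.
  rewrite /ubase /= => -> -> [_ + _] ey; rewrite ey ifF; last by lia.
  by move=> ->.
have zE : t (uat a o (x n)) = (ubase (t (uat a o (x n))), a, o).
  by apply: (uat_child zc); rewrite en.
rewrite zE [LHS]uat_high ?en1; last by lia.
by rewrite (high n on N1n) [uat a o (x n)]uat_high ?en.
Qed.

Lemma legalize_eq (s s' : T -> T) v : s v = s' v -> legalize s v = legalize s' v.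
Proof. by move=> e; rewrite /legalize e. Qed.

Section Low.
Variables (b : bool) (t : unfolding -> unfolding) (cand : T -> T) (x : nat -> T).
Hypotheses (st : strategy b t) (px : play x).
Hypothesis cand_low : forall v, lvl v <= N -> cand v = ubase (t (v, blank_set, blank_option)).

Lemma ubase_child a o v : ulegal (v, a, o) -> odd (lvl v) = b ->
  child v (ubase (t (v, a, o))).
Proof.
move=> lv ov; have [lt et pt] := st (v := (v, a, o)) lv ov.
by have [? _ e] := ubase_morphism lt; split=> //; rewrite -e pt.
Qed.

Lemma cand_lowE v : legal v -> lvl v <= N -> odd (lvl v) = b ->
  legalize cand v = ubase (t (v, blank_set, blank_option)).
Proof.
move=> lv vN ov; rewrite legalizeE cand_low//.
by apply: ubase_child => //; exact: ubase_surj.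
Qed.

End Low.

Hypothesis evenN : odd N = false.

Definition claimed (t : unfolding -> unfolding) v := (t (anc N v, blank_set, blank_option)).1.2.

(* Once [E] is met, I pretends that II had announced the first node in [E]; while
   I can force [E] inside [a] he does so; otherwise he pretends that II had
   announced the quasistrategy of never letting I force [E]. *)
Definition translate1 (t : unfolding -> unfolding) v : T :=
  if lvl v <= N then ubase (t (v, blank_set, blank_option)) else
  let a := claimed t v in
  if `[<E v>] then ubase (t (v, a, inl (first_anc N.+2 E v)))
  else if `[<entered N.+2 (reach false a E) v>]
  then reach_strategy false a E N.+2 v
  else ubase (t (v, a, inr (safe false a E (anc N.+2 v)))).

Lemma transfer1 : transfer N false ubase (fun t => legalize (translate1 t)).
Proof.
split=> [t t' n tt' v vn|t st].
  have e w a o : lvl w <= n -> t (w, a, o) = t' (w, a, o) by move=> wn; exact: tt'.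
  apply: legalize_eq; rewrite /translate1; case: leqP => vN; first by rewrite e.
  have -> : claimed t v = claimed t' v.
    by rewrite /claimed e// lvl_anc; lia.
  by rewrite !e.
have low v : lvl v <= N -> translate1 t v = ubase (t (v, blank_set, blank_option)) by rewrite /translate1 => ->.
split.
- by move=> v lv _; exact: legalizeP.
- case=> -[v a] o lv vN; rewrite /ubase /= in vN * => ov.
  have [lv' va vo _ _] := lv.
  by rewrite (cand_lowE st low)// ?va ?vo//; move: vN; rewrite /ulvl /=; lia.
move=> x px xs; set a := claimed t (x N).
have lN := play_lvl N px; have lN1 := play_lvl N.+1 px.
have claimE n : N <= n -> claimed t (x n) = a.
  by move=> Nn; rewrite /a /claimed !anc_play.
have xlow n : odd n = false -> n <= N -> x n.+1 = ubase (t (x n, blank_set, blank_option)).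
  move=> on nN; rewrite xs// (cand_lowE st low)//; [exact: play_legal|..];
    by rewrite play_lvl.
have qa : quasi false (x N.+1) (@legal T) a.
  have lz : ulegal (x N, blank_set, blank_option) by apply: ubase_surj; rewrite ?lN//; exact: play_legal.
  have [] := st (x N, blank_set, blank_option) lz; first by rewrite /= /ulvl /= lN.
  rewrite /a /claimed anc_play//; have := xlow N evenN (leqnn N).
  rewrite /ubase; case: (t _) => -[y a'] o' /= <- [_ _ _ + _] _ _.
  by rewrite lN1 (@anc_ge _ N.+1) ?lN1//; apply.
have [ac al ap aopp aown] := qa.
set R := reach false a E; set Sf := safe false a E (x N.+2).
have safeE n : N.+1 < n -> a (x n) -> ~ entered N.+2 R (x n) -> Sf (x n).
  by move=> Nn an ne; split; rewrite ?play_lvl// anc_play.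
have aN2 : a (x N.+2).
  by apply: (aopp (x N.+1)) => //; [rewrite lN1 /= evenN|exact: play_child|exact: play_legal].
have qS : ~ R (x N.+2) -> quasi true (x N.+2) a Sf /\ forall v, Sf v -> ~ E v.
  apply: (@safe_quasi false) => //.
  by move=> v av; rewrite play_lvl// => vN; apply: ap => //; rewrite lN1; lia.
have wait n : odd n = false -> N.+1 < n -> a (x n) -> ~ E (x n) ->
    entered N.+2 R (x n) -> x n.+1 = reach_strategy false a E N.+2 (x n) /\ a (x n.+1).
  move=> on Nn an nE en; have ln := play_lvl n px.
  have [c r] := reach_strategy_confined E aown N.+2 an (etrans (congr1 odd ln) on).
  have e : translate1 t (x n) = reach_strategy false a E N.+2 (x n).
    rewrite /translate1 ifF ?ln; last by lia.
    by rewrite claimE; [case: asboolP => // _; case: asboolP|lia].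
  by rewrite xs// legalizeE ?e.
have stay n : odd n = false -> N.+1 < n -> a (x n) -> ~ E (x n) ->
    ~ entered N.+2 R (x n) -> x n.+1 = ubase (t (x n, a, inr Sf)) /\ Sf (x n.+1).
  move=> on Nn an nE ne; have ln := play_lvl n px.
  have [qS1 qS2] : quasi true (x N.+2) a Sf /\ forall v, Sf v -> ~ E v.
    by apply: qS => r; apply: ne; apply/(entered_play _ _ _ px); exists N.+2 => //; lia.
  have lz : ulegal (x n, a, inr Sf).
    rewrite -uat_high ?ln//; apply: uat_legal => // _; split=> //; exact: safeE.
  have on' : odd (lvl (x n)) = false by rewrite ln.
  have c := ubase_child st lz on'.
  have e : translate1 t (x n) = ubase (t (x n, a, inr Sf)).
    rewrite /translate1 ifF ?ln; last by lia.
    rewrite claimE; last by lia.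
    by case: asboolP => // _; case: asboolP => // _; rewrite anc_play.
  rewrite xs// legalizeE ?e//; split=> //.
  apply: (uat_follow_stay (a := a) (v := x n)); last by rewrite ln.
  by rewrite uat_high ?ln//; exact: st.
(* Until [E] is met the play stays in [a], so the first node in [E] is one that II could legally
   have announced. *)
have inside n : N < n -> (forall j, N.+1 < j < n -> ~ E (x j)) -> a (x n).
  elim: n => // n IH Nn nE; have [->//|ne] := eqVneq n N.
  have an : a (x n) by apply: IH => [|j jn]; [lia|apply: nE; lia].
  have ln := play_lvl n px.
  case: (boolP (odd n)) => [|/negbTE] on.
    by apply: (aopp (x n)) => //; [rewrite ln on|exact: play_child|exact: play_legal].
  have Nn1 : N.+1 < n.
    have [|nN1] := ltnP N.+1 n; first by [].
    have nE1 : n = N.+1 by lia.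
    by move: on; rewrite nE1 /= evenN.
  have nEn : ~ E (x n) by apply: nE; lia.
  have [en|nen] := pselect (entered N.+2 R (x n)); first by case: (wait n).
  by have [_ []] := stay n on Nn1 an nEn nen.
have lift o : (forall n, N.+1 < n -> match o with
     | inl u => [/\ a u, E u, N.+1 < lvl u & anc n u = anc (lvl u) (x n)]
     | inr s => [/\ quasi true (x N.+2) a s, forall v, s v -> ~ E v & s (x n)]
     end) ->
    (forall n, odd n = false -> N.+1 < n -> x n.+1 = ubase (t (x n, a, o))) ->
    exists y : nat -> unfolding, [/\ play y, follows false t y & forall n, x n = ubase (y n)].
  move=> ho hx; apply: (unfolding_lift (a := a) (o := o) st px) => //.
  - by move=> n; apply: uat_legal => //; exact: ho.
  - by move=> _; rewrite /a /claimed anc_play.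
  - by rewrite /= evenN.
have [[n Nn En]|never] := pselect (exists2 n, N.+1 < n & E (x n)).
  have [m [mn Em mmin]] := least_from (P := fun n => E (x n)) Nn En.
  have lm := play_lvl m px.
  have am : a (x m) by apply: inside => //; lia.
  apply: (lift (inl (x m))) => [i Ni|i oi Ni].
    by split=> //; [rewrite lm; lia|rewrite lm; exact: anc_play_sym].
  have li := play_lvl i px.
  have lz : ulegal (x i, a, inl (x m)).
    rewrite -uat_high ?li//; apply: uat_legal => // _.
    by split=> //; [rewrite lm; lia|rewrite lm; exact: anc_play_sym].
  have oi' : odd (lvl (x i)) = false by rewrite li.
  (* Before level [m], legality forces [t] to move towards [x m]; hence the move made agrees with
     [t], although it was chosen under another pretence. *)
  have [im|mi] := ltnP i m.
    rewrite (uat_follow_exit (a := a) (u := x m) (v := x i)).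
    - by rewrite li anc_play.
    - by rewrite uat_high ?li//; exact: st.
    - by rewrite li lm; lia.
  have Ei : E (x i).
    rewrite -(subnKC mi); elim: (i - m) => [|d]; rewrite ?addn0// addnS.
    by apply: E_child; exact: play_child.
  have e : translate1 t (x i) = ubase (t (x i, a, inl (x m))).
    rewrite /translate1 ifF ?li; last by lia.
    rewrite claimE; last by lia.
    by case: asboolP => // _; rewrite (first_anc_play (m := m) px)//; lia.
  have c := ubase_child st lz oi'.
  by rewrite xs// legalizeE ?e.
have nE n : N.+1 < n -> ~ E (x n) by move=> Nn En; apply: never; exists n.
have inA n : N < n -> a (x n) by move=> Nn; apply: inside => // j jn; apply: nE; lia.
(* Once inside the attractor, I would have forced [E]. *)
have nent n : ~ entered N.+2 R (x n).
  move/(entered_play _ _ _ px) => -[m mn Rm]; apply: never.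
  apply: (reach_strategyP aown px _ Rm); first by lia.
    by move=> j Nj; apply: inA; lia.
  by move=> j Nj ej oj; case: (wait j oj Nj) => //; [apply: inA; lia|exact: nE].
have [qS1 qS2] : quasi true (x N.+2) a Sf /\ forall v, Sf v -> ~ E v.
  apply: qS => r; apply: (nent N.+2); apply/(entered_play _ _ _ px).
  by exists N.+2 => //; rewrite leqnn.
apply: (lift (inr Sf)) => [n Nn|n on Nn].
  by split=> //; apply: safeE => //; apply: inA; lia.
by have [] := stay n on Nn (inA n (ltnW Nn)) (nE n Nn) (nent n).
Qed.

Definition hit (t : unfolding -> unfolding) c u :=
  N.+1 < lvl u /\
  exists a, quasi false c (@legal T) a /\ (t (c, a, blank_option)).2 = inl u.

Definition hit_label (t : unfolding -> unfolding) c u :=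
  some_such blank_set (fun a => quasi false c (@legal T) a /\ (t (c, a, blank_option)).2 = inl u).

(* II tries to force a node [u] that [t] could have announced, and from then on
   follows [t] against the corresponding quasistrategy. While this cannot be
   forced, he plays against I's quasistrategy of avoiding all such nodes, to which
   [t] cannot answer by announcing one. *)
Definition translate2 (t : unfolding -> unfolding) v : T :=
  if lvl v <= N then ubase (t (v, blank_set, blank_option)) else
  let c := anc N.+1 v in
  if `[<entered N.+2 (hit t c) v>] then
    let u := first_anc N.+2 (hit t c) v in ubase (t (v, hit_label t c u, inl u))
  else if `[<entered N.+1 (reach true (@legal T) (hit t c)) v>]
  then reach_strategy true (@legal T) (hit t c) N.+1 v
  else let a := safe true (@legal T) (hit t c) c in
    ubase (t (uat a (t (c, a, blank_option)).2 v)).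

Lemma transfer2 : transfer N true ubase (fun t => legalize (translate2 t)).
Proof.
split=> [t t' n tt' v vn|t st].
  have e w a o : lvl w <= n -> t (w, a, o) = t' (w, a, o) by move=> wn; exact: tt'.
  apply: legalize_eq; rewrite /translate2; case: leqP => vN; first by rewrite e.
  have ec a : t (anc N.+1 v, a, blank_option) = t' (anc N.+1 v, a, blank_option) by rewrite e// lvl_anc; lia.
  have -> : hit t (anc N.+1 v) = hit t' (anc N.+1 v).
    apply/funext => u; apply/propext; split=> -[Nu [a [qa h]]]; split=> //;
      by exists a; rewrite ?ec// -ec.
  have -> : hit_label t (anc N.+1 v) = hit_label t' (anc N.+1 v).
    apply/funext => u; rewrite /hit_label; congr some_such.
    by apply/funext => a; rewrite ec.
  by rewrite /= ec /uat !e.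
have low v : lvl v <= N -> translate2 t v = ubase (t (v, blank_set, blank_option)) by rewrite /translate2 => ->.
split.
- by move=> v lv _; exact: legalizeP.
- case=> -[v a] o lv vN; rewrite /ubase /= in vN * => ov.
  have [lv' va vo _ _] := lv.
  by rewrite (cand_lowE st low)// ?va ?vo//; move: vN; rewrite /ulvl /=; lia.
move=> x px xs; set c := x N.+1; pose U := hit t c.
have lN1 := play_lvl N.+1 px; have lc : legal c by exact: play_legal.
have ancE n : N < n -> anc N.+1 (x n) = c by move=> Nn; rewrite anc_play.
have xlow n : odd n = true -> n <= N -> x n.+1 = ubase (t (x n, blank_set, blank_option)).
  move=> on nN; rewrite xs// (cand_lowE st low)//; [exact: play_legal|..];
    by rewrite play_lvl.
have legal_move v : legal v -> odd (lvl v) = true -> exists2 w, child v w & legal w.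
  by move=> lv _; have [w vw] := has_child lv; exists w => //; case: vw.
have answer a : quasi false c (@legal T) a ->
    exists y o, [/\ t (c, a, blank_option) = (y, a, o), child c y & ulegal (y, a, o)].
  move=> qa; have lz : ulegal (c, a, blank_option).
    by rewrite -(uat_mid a blank_option lN1); apply: uat_legal => //; lia.
  have oc : odd (lvl c) = true by rewrite lN1 /= evenN.
  have := ubase_child st lz oc; have := st (c, a, blank_option) lz oc.
  case: (t _) => -[y a'] o'; rewrite /ubase /= => -[lt _ []] py + _ cy.
  have [_ ey _] := cy; rewrite ey lN1 ifF; last by lia.
  by move=> aE; exists y, o'; rewrite -aE.
have lift a o : quasi false c (@legal T) a ->
    (forall n, N.+1 < n -> match o with
     | inl u => [/\ a u, E u, N.+1 < lvl u & anc n u = anc (lvl u) (x n)]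
     | inr s => [/\ quasi true (x N.+2) a s, forall v, s v -> ~ E v & s (x n)]
     end) ->
    t (c, a, blank_option) = (x N.+2, a, o) ->
    (forall n, odd n = true -> N.+1 < n -> x n.+1 = ubase (t (x n, a, o))) ->
    exists y : nat -> unfolding, [/\ play y, follows true t y & forall n, x n = ubase (y n)].
  move=> qa ho tc hx; apply: (unfolding_lift (a := a) (o := o) st px) => //.
  - by move=> n; apply: uat_legal => //; exact: ho.
  - by rewrite evenN.
  - by move=> _; rewrite -/c tc.
have [[n Nn Un]|never] := pselect (exists2 n, N.+1 < n & U (x n)).
  have [m [mn Um mmin]] := least_from (P := fun n => U (x n)) Nn Un.
  have lm := play_lvl m px; set a := hit_label t c (x m).
  have [qa ta] : quasi false c (@legal T) a /\ (t (c, a, blank_option)).2 = inl (x m).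
    exact: (@some_suchP _ _ (fun a => quasi false c (@legal T) a /\ (t (c, a, blank_option)).2 = inl (x m))) Um.2.
  have [y [o [te cy]]] := answer a qa; move: ta; rewrite te /= => oE.
  rewrite {}oE in te *; have [_ ey _] := cy.
  rewrite /= ey lN1 => -[_ _ _ _ [//|am Em _]]; rewrite lm => yE.
  (* II moved to [x N.+2] before knowing which node would be hit; since the announced [x m] extends
     the move [y] of [t], the two moves coincide. *)
  have {}yE : y = x N.+2.
    by rewrite -(anc_play (n := m) px) ?yE ?anc_ge// ?ey ?lN1; lia.
  have ho i : N.+1 < i ->
      [/\ a (x m), E (x m), N.+1 < lvl (x m) & anc i (x m) = anc (lvl (x m)) (x i)].
    by move=> Ni; split=> //; rewrite lm; [lia|exact: anc_play_sym].
  apply: (lift a (inl (x m))) => //; first by rewrite te yE.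
  move=> i oi Ni; have li := play_lvl i px.
  have lz : ulegal (x i, a, inl (x m)).
    by rewrite -uat_high ?li//; apply: uat_legal => // _; exact: ho.
  have oi' : odd (lvl (x i)) = true by rewrite li.
  have [im|mi] := ltnP i m.
    rewrite (uat_follow_exit (a := a) (u := x m) (v := x i)).
    - by rewrite li anc_play.
    - by rewrite uat_high ?li//; exact: st.
    - by rewrite li lm; lia.
  have e : translate2 t (x i) = ubase (t (x i, a, inl (x m))).
    rewrite /translate2 ifF ?li; last by lia.
    rewrite ancE; last by lia.
    case: asboolP => [_|[]]; last by apply/(entered_play _ _ _ px); exists m => //; lia.
    by rewrite (first_anc_play (m := m) px)//; lia.
  have ci := ubase_child st lz oi'.
  by rewrite xs// legalizeE ?e.
have nU n : ~ entered N.+2 U (x n).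
  by move/(entered_play _ _ _ px) => -[m mn Um]; apply: never; exists m => //; lia.
set R := reach true (@legal T) U.
have nR n : ~ entered N.+1 R (x n).
  move/(entered_play _ _ _ px) => -[m mn Rm].
  have [|||n' Nn' Un'] := reach_strategyP (n0 := N.+1) legal_move px _ Rm; first by lia.
  - by move=> j _; exact: play_legal.
  - move=> j Nj ej oj; have lj := play_lvl j px; have oj' : odd (lvl (x j)) = true by rewrite lj.
    have [cj _] := reach_strategy_confined U legal_move N.+1 (play_legal j px) oj'.
    have e : translate2 t (x j) = reach_strategy true (@legal T) U N.+1 (x j).
      rewrite /translate2 ifF ?lj; last by lia.
      rewrite ancE; last by lia.
      by case: asboolP => [/nU//|_]; case: asboolP.
    by rewrite xs// legalizeE ?e.
  - by apply: never; exists n' => //; case: Un'; rewrite play_lvl.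
set a := safe true (@legal T) U c.
have [qa aU] : quasi false c (@legal T) a /\ forall v, a v -> ~ U v.
  apply: (@safe_quasi true) => //; first by move=> v lv _; exact: legal_par.
  by move=> r; apply: (nR N.+1); apply/(entered_play _ _ _ px); exists N.+1; rewrite ?leqnn.
have inA n : N < n -> a (x n).
  move=> Nn; split; [exact: play_legal|by rewrite lN1 play_lvl|by rewrite lN1 ancE|].
  by rewrite lN1; exact: nR.
have [y [o [te cy ly]]] := answer a qa.
have candE n : N < n -> translate2 t (x n) = ubase (t (uat a o (x n))).
  move=> Nn; rewrite /translate2 ifF ?play_lvl//; last by lia.
  rewrite ancE//; case: asboolP => [/nU//|_]; case: asboolP => [/nR//|_].
  by rewrite -/U -/a te.
have yE : y = x N.+2.
  have e : translate2 t c = y by rewrite candE// uat_mid// -/c te.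
  by rewrite xs /= ?evenN// legalizeE ?e.
rewrite {}yE in te ly cy.
case: o te ly candE => [u|s] te ly candE.
  (* A node announced against [a] would be a hit lying in [a], whereas [a] avoids all hits. *)
  have [_ _ _ _] := ly; rewrite play_lvl// => -[//|au _ Nu _].
  by case: (aU u au); split=> //; exists a; rewrite te.
have [_ _ _ _] := ly; rewrite play_lvl// => -[//|+ sE sN2].
rewrite anc_play// => qs; have [_ sa _ sopp _] := qs.
have main n : N.+1 < n -> s (x n) /\
    (odd n = true -> s (x n) -> x n.+1 = ubase (t (x n, a, inr s)) /\ s (x n.+1)).
  elim: n => // n IH Nn.
  have step m : N.+1 < m -> odd m = true -> s (x m) ->
      x m.+1 = ubase (t (x m, a, inr s)) /\ s (x m.+1).
    move=> Nm om sm; have lm := play_lvl m px.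
    have lz : ulegal (x m, a, inr s).
      by rewrite -uat_high ?lm//; apply: uat_legal => // _; split.
    have om' : odd (lvl (x m)) = true by rewrite lm.
    have cm := ubase_child st lz om'.
    have e : x m.+1 = ubase (t (x m, a, inr s)).
      by rewrite xs// legalizeE candE ?uat_high ?lm//; lia.
    split=> //; rewrite e; apply: (uat_follow_stay (a := a) (v := x m)); last by rewrite lm.
    by rewrite uat_high ?lm//; exact: st.
  split; last exact: step.
  have [E2|ne] := eqVneq n.+1 N.+2; first by rewrite E2.
  have [|sn _] := IH; first by lia.
  case: (boolP (odd n)) => [|/negbTE] on; first by apply: (step n _ on sn).2; lia.
  apply: (sopp (x n)) => //; [by rewrite play_lvl// on|exact: play_child|].
  by apply: inA; lia.
apply: (lift a (inr s)) => // [n Nn|n on Nn]; first by split=> //; case: (main n Nn).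
by have [sn /(_ on sn)[]] := main n Nn.
Qed.

Lemma unfolding_covering : covering N ubase.
Proof.
split; [exact: ubase_morphism|exact: ubase_inj| |].
  by move=> w lw wN; exists (w, blank_set, blank_option) => //; exact: ubase_surj.
by case; [exists (fun t => legalize (translate2 t)); exact: transfer2
  |exists (fun t => legalize (translate1 t)); exact: transfer1].
Qed.

End Unfolding.

(** * Borel determinacy *)

Section Determinacy.
Implicit Types T : tree.

Lemma covering_le k n T' T (p : T' -> T) : k <= n -> covering n p -> covering k p.
Proof.
move=> kn [mp inj surj tr]; split=> //.
- by move=> v w lv lw vk; apply: inj => //; lia.
- by move=> w lw wk; apply: surj => //; lia.
- move=> b; have [phi [loc h]] := tr b; exists phi; split=> // s ss.
  by have [h1 h2 h3] := h s ss; split=> // v lv vk; apply: h2 => //; lia.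
Qed.

Definition clopen_payoff T (Y : (nat -> T) -> Prop) := forall x, play x ->
  exists n, forall y, play y -> y n = x n -> (Y x <-> Y y).

Definition open_payoff T (Y : (nat -> T) -> Prop) := forall x, play x -> Y x ->
  exists n, forall y, play y -> y n = x n -> Y y.

Lemma clopen_open T (Y : (nat -> T) -> Prop) : clopen_payoff Y -> open_payoff Y.
Proof. by move=> cY x px Yx; have [n h] := cY x px; exists n => y py /(h y py)[hY _]; exact: hY. Qed.

(** This set of nodes is closed under children and generates an open [Y], so it can serve as [E] in
    the unfolding. *)
Definition sure T (Y : (nat -> T) -> Prop) v :=
  forall x, play x -> x (lvl v) = v -> Y x.

Lemma sure_open T (Y : (nat -> T) -> Prop) x : open_payoff Y -> play x ->
  (exists n, sure Y (x n)) <-> Y x.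
Proof.
move=> oY px; split=> [[n h]|/(oY x px)[n h]]; first by apply: h => //; rewrite play_lvl.
by exists n => y py; rewrite play_lvl//; exact: h.
Qed.

Lemma open_unfold T (Y : (nat -> T) -> Prop) k : open_payoff Y ->
  exists T' (p : T' -> T), covering k p /\ clopen_payoff (fun x => Y (p \o x)).
Proof.
move=> oY.
have up v w : child v w -> sure Y v -> sure Y w.
  move=> [_ lw pw] sv x px xw; apply: sv => //.
  by have [_ _ <-] := px (lvl v); rewrite -lw xw.
(* [k.*2] is an even level not below [k]; evenness makes level [N] a move of player I. *)
exists (unfolding k.*2 (sure Y)), (@ubase _ _ _); split.
  apply: (@covering_le _ k.*2); first by lia.
  by apply: unfolding_covering => //; exact: odd_double.
have YE (x : nat -> unfolding k.*2 (sure Y)) : play x -> Y (@ubase _ _ _ \o x) <->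
    (if (x k.*2.+2).2 is inl _ then True else False).
  move=> px; rewrite -(ubase_clopen up px); apply: iff_sym.
  apply: (@sure_open _ _ (@ubase _ _ _ \o x)) => //.
  exact: morphism_play (@ubase_morphism _ _ _) px.
move=> x px; exists k.*2.+2 => y py yx.
by rewrite (YE x px) (YE y py) yx.
Qed.

(* The quantification over [q] makes the property survive the passage to the next
   tree of a tower. *)
Definition unravelable T (Y : (nat -> T) -> Prop) :=
  forall T' (q : T' -> T), morphism q -> forall k,
  exists T'' (p : T'' -> T'), covering k p /\ clopen_payoff (fun x => Y (q \o p \o x)).

Lemma unravelable_ext T (Y Z : (nat -> T) -> Prop) :
  (forall x, play x -> Y x <-> Z x) -> unravelable Y -> unravelable Z.
Proof.
move=> YZ uY T' q mq k; have [T'' [p [cp h]]] := uY T' q mq k.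
exists T'', p; split=> // x px; have [n hn] := h x px; exists n => y py yx.
have mqp : morphism (q \o p) by apply: morphism_comp => //; case: cp.
by rewrite -!YZ; [exact: hn|exact: morphism_play|exact: morphism_play].
Qed.

Lemma unravelable_open T (Y : (nat -> T) -> Prop) : open_payoff Y -> unravelable Y.
Proof.
move=> oY T' q mq k; apply: (@open_unfold _ (fun x => Y (q \o x))) => x px Yx.
have [n h] := oY _ (morphism_play mq px) Yx.
by exists n => y py yx; apply: h; [exact: morphism_play|rewrite /= yx].
Qed.

Lemma unravelable_compl T (Y : (nat -> T) -> Prop) :
  unravelable Y -> unravelable (fun x => ~ Y x).
Proof.
move=> uY T' q mq k; have [T'' [p [cp h]]] := uY T' q mq k.
exists T'', p; split=> // x px; have [n hn] := h x px; exists n => y py yx.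
by have := hn y py yx; tauto.
Qed.

(** Each tree of the tower carries its map to the base, through which the next set is pulled
    back. *)
Record tree_over T := TreeOver {
  total :> tree; down : total -> T; down_morphism : morphism down }.

Lemma unravelable_bigcup T (Y : nat -> (nat -> T) -> Prop) :
  (forall i, unravelable (Y i)) -> unravelable (fun x => exists i, Y i x).
Proof.
move=> uY T' q mq k.
have step i (g : tree_over T') : {g' : tree_over T' & {p : g' -> g |
    [/\ covering (k + i) p, clopen_payoff (fun x => Y i (q \o down (t := g') \o x))
      & forall v, down (p v) = down v]}}.
  have [S h] := cid (uY i g (q \o down (t := g)) (morphism_comp (down_morphism (t := g)) mq) (k + i)).
  have [p [cp h']] := cid h.
  have mp : morphism (down (t := g) \o p).
    by apply: morphism_comp; [case: cp|exact: down_morphism].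
  by exists (TreeOver mp), p; split.
have mid : morphism (@id T') by [].
pose G := fix G i : tree_over T' :=
  match i with 0 => TreeOver mid | i.+1 => projT1 (step i (G i)) end.
pose p i : G i.+1 -> G i := sval (projT2 (step i (G i))).
have pP i : [/\ covering (k + i) (@p i),
    clopen_payoff (fun x => Y i (q \o down (t := G i.+1) \o x))
    & forall v, down (p i v) = down v] by exact: svalP (projT2 (step i (G i))).
have covp i : covering (k + i) (@p i) by have [] := pP i.
pose L := limit covp.
have downE i (v : L) : legal v -> down (v i) = v 0.
  by move=> tv; elim: i => // i <-; have [_ _ <-] := pP i; rewrite (tv i).2.
have c0 := limit_covering covp.
(* A play of [L] projects to one of [G i.+1], where [Y i] is already clopen. *)
have oL : open_payoff (fun x : nat -> L => exists i, Y i (q \o (@proj _ _ _ covp 0 \o x))).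
  move=> x px [i Yi]; have [_ cY _] := pP i.
  have toproj (y : nat -> L) : play y ->
      q \o down (t := G i.+1) \o (@proj _ _ _ covp i.+1 \o y) = q \o (@proj _ _ _ covp 0 \o y).
    by move=> py; apply/funext => n; exact: (congr1 q (downE i.+1 (y n) (play_legal n py))).
  have [n hn] := cY _ (morphism_play (@proj_morphism _ _ _ covp i.+1) px).
  exists n => y py yx; exists i; rewrite -toproj//; apply/(hn _ _ _).1; last by rewrite toproj.
    exact: (morphism_play (@proj_morphism _ _ _ covp i.+1) py).
  by rewrite /= yx.
have [S [r [cr h]]] := open_unfold k oL.
exists S, (@proj _ _ _ covp 0 \o r); split=> //; exact: covering_comp cr c0.
Qed.

Lemma unravelable_or T (Y Z : (nat -> T) -> Prop) :
  unravelable Y -> unravelable Z -> unravelable (fun x => Y x \/ Z x).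
Proof.
move=> uY uZ; apply: (@unravelable_ext _ (fun x => exists i, (if i is 0 then Y else Z) x)).
  by move=> x px; split=> [[[|i] h]|[h|h]]; [left|right|exists 0|exists 1].
by apply: unravelable_bigcup => -[].
Qed.

Definition wins_for T b (Y : (nat -> T) -> Prop) (s : T -> T) :=
  strategy b s /\ forall x, play x -> follows b s x -> Y x.

(** The Gale-Stewart theorem: if the root is outside I's attractor of the sure nodes, II wins by
    staying outside. *)
Lemma open_determinacy T (r : T) (Y : (nat -> T) -> Prop) : legal r ->
  (forall v, legal v -> lvl v = 0 -> v = r) -> open_payoff Y ->
  (exists s, wins_for false Y s) \/ (exists s, wins_for true (fun x => ~ Y x) s).
Proof.
move=> lr rr oY.
have l0 : lvl r = 0 by rewrite -(rr (anc 0 r)) ?lvl_anc//; exact: legal_anc.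
have legal_move (v : T) : legal v -> odd (lvl v) = false -> exists2 w, child v w & legal w.
  by move=> lv _; have [w vw] := has_child lv; exists w => //; case: vw.
have [[s sc sf]|nr] := pselect (reach false (@legal T) (sure Y) r).
  left; exists s; split=> [v lv ov|x px xs]; first by case: (sc v lv ov).
  apply/(sure_open oY px); have [|n _|n _ on|n _ h] := sf x px.
  - by rewrite l0; apply: rr; [exact: play_legal|exact: play_lvl].
  - exact: play_legal.
  - exact: xs.
  - by exists n.
right; pose R := reach false (@legal T) (sure Y).
pose s v := some_such (legalize id v) (fun w => child v w /\ ~ R w).
have sR v : legal v -> odd (lvl v) = true -> ~ R v -> ~ R (s v).
  move=> lv ov nv; suff /(some_suchP (legalize id v)) [] : exists w, child v w /\ ~ R w by [].
  apply: contrapT => none; apply: nv; apply: (reach_opp legal_move); first by rewrite ov.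
  by move=> w vw _; apply: contrapT => nw; apply: none; exists w.
exists s; split=> [v lv ov|x px xs].
  rewrite /s; have [ex|nex] := pselect (exists w, child v w /\ ~ R w).
    by case: (some_suchP (legalize id v) ex).
  by rewrite /some_such; case: pselect => // _; exact: legalizeP.
have nR n : ~ R (x n).
  elim: n => [|n IH]; first by rewrite (rr (x 0))//; [exact: play_legal|exact: play_lvl].
  case: (boolP (odd n)) => [|/negbTE] on.
    by rewrite xs//; apply: sR => //; [exact: play_legal|rewrite play_lvl].
  move=> r1; apply: IH; apply: (reach_own legal_move _ (play_child n px)) => //.
    by rewrite play_lvl.
  exact: play_legal.
by move/(sure_open oY px) => -[n h]; apply: (nR n); exact: reach_target.
Qed.

Theorem determinacy T (r : T) (Y : (nat -> T) -> Prop) : legal r ->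
  (forall v, legal v -> lvl v = 0 -> v = r) -> unravelable Y ->
  (exists s, wins_for false Y s) \/ (exists s, wins_for true (fun x => ~ Y x) s).
Proof.
move=> lr rr uY; have mid : morphism (@id T) by [].
have [S [p [cp cY]]] := uY T id mid 0; have [mp inj surj tr] := cp.
have l0 : lvl r = 0 by rewrite -(rr (anc 0 r)) ?lvl_anc//; exact: legal_anc.
have [|r' lr' pr'] := surj r lr; first by rewrite l0.
(* A play following the translated strategy is the image of a play won in the covering tree. *)
have back b Z : (exists s, wins_for b (fun x => Z (p \o x)) s) ->
    exists s, @wins_for T b Z s.
  move=> [s [ss sw]]; have [phi [_ h]] := tr b; have [h1 _ h3] := h s ss.
  exists (phi s); split=> // x px xs; have [y [py ys xy]] := h3 x px xs.
  by rewrite (_ : x = p \o y); [exact: sw|exact/funext].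
have [||||] := @open_determinacy S r' (fun x => Y (p \o x)) => //.
- move=> v lv v0; apply: inj => //; first by rewrite v0.
  by rewrite pr'; apply: rr; case: (mp v lv) => // _ ->.
- exact: clopen_open.
- by left; exact: (back false Y).
- by right; exact: (back true (fun x => ~ Y x)).
Qed.

End Determinacy.

(** * The Wadge game and the Martin-Monk argument *)

Section Cantor.
Local Notation C := (nat -> bool).
Implicit Types (z : C) (O Z D : C -> Prop).

Definition agree n z z' := forall i, i < n -> z i = z' i.

Definition copen O := forall z, O z -> exists n, forall z', agree n z z' -> O z'.

Definition cdense O := forall z n, exists z', agree n z z' /\ O z'.

Definition comeager Z := exists D : nat -> C -> Prop,
  (forall i, copen (D i) /\ cdense (D i)) /\ forall z, (forall i, D i z) -> Z z.

Definition baire_property Z := exists O, copen O /\ comeager (fun z => Z z <-> O z).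

Lemma comeager_bigcap (Z : nat -> C -> Prop) :
  (forall i, comeager (Z i)) -> comeager (fun z => forall i, Z i z).
Proof.
move=> /choice[D DP].
exists (fun k => if unpickle k is Some ij then D ij.1 ij.2 else fun=> True).
split=> [k|z h i].
  case: unpickle => [[i j]|]; first exact: (DP i).1.
  by split=> [z _|z n]; [exists 0|exists z].
by apply: (DP i).2 => j; have := h (pickle (i, j)); rewrite pickleK.
Qed.

Lemma comeagerS Z Z' : (forall z, Z z -> Z' z) -> comeager Z -> comeager Z'.
Proof. by move=> ZZ' [D [h1 h2]]; exists D; split=> // z /h2/ZZ'. Qed.

Lemma comeagerI Z Z' : comeager Z -> comeager Z' -> comeager (fun z => Z z /\ Z' z).
Proof.
move=> cZ cZ'; have : comeager (fun z => forall i, (if i is 0 then Z else Z') z).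
  by apply: (@comeager_bigcap (fun i => if i is 0 then Z else Z')) => -[].
by apply: comeagerS => z h; split; [exact: (h 0)|exact: (h 1)].
Qed.

Lemma baire_open O : copen O -> baire_property O.
Proof.
move=> oO; exists O; split=> //; exists (fun=> fun=> True); split=> // _.
by split=> [z _|z n]; [exists 0|exists z].
Qed.

Lemma baire_bigcup (Z : nat -> C -> Prop) : (forall i, baire_property (Z i)) ->
  baire_property (fun z => exists i, Z i z).
Proof.
move=> /choice[O OP]; exists (fun z => exists i, O i z); split.
  by move=> z [i /(OP i).1[n h]]; exists n => z' /h; exists i.
apply: (comeagerS _ (comeager_bigcap (fun i => (OP i).2))) => z h.
by split=> -[i]; exists i; apply/h.
Qed.

Lemma agree_trans n z1 z2 z3 : agree n z1 z2 -> agree n z2 z3 -> agree n z1 z3.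
Proof. by move=> h1 h2 i ni; rewrite h1 ?h2. Qed.

Lemma agree_le m n z z' : m <= n -> agree n z z' -> agree m z z'.
Proof. by move=> mn h i im; apply: h; lia. Qed.

(** The exterior [O'] of [O] represents the complement: the two open sets together are dense. *)
Lemma baire_compl Z : baire_property Z -> baire_property (fun z => ~ Z z).
Proof.
move=> [O [oO cO]]; pose O' z := exists n, forall z', agree n z z' -> ~ O z'.
have oO' : copen O'.
  move=> z [n h]; exists n => z' zz'; exists n => z'' zz''.
  by apply: h; exact: agree_trans zz''.
exists O'; split=> //; have : comeager (fun z => O z \/ O' z).
  exists (fun=> fun z => O z \/ O' z); split=> [_|z /(_ 0)//]; split.
    move=> z [/oO|/oO'] [n h]; exists n => z' /h; by [left|right].
  move=> z n; have [[z' [zz' Oz']]|none] := pselect (exists z', agree n z z' /\ O z').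
    by exists z'; split; [|left].
  by exists z; split=> //; right; exists n => z' zz' Oz'; apply: none; exists z'.
move=> /(comeagerI cO); apply: comeagerS => z [ZO OO'].
rewrite ZO; split=> [nO|[n h] Oz]; first by case: OO'.
exact: (h z).
Qed.

Lemma baire_category (D : nat -> C -> Prop) z0 n0 :
  (forall i, copen (D i) /\ cdense (D i)) ->
  exists z, agree n0 z0 z /\ forall i, D i z.
Proof.
move=> DP.
have step i (s : C * nat) : exists s' : C * nat, [/\ s.2 < s'.2, agree s.2 s.1 s'.1 &
    forall z, agree s'.2 s'.1 z -> D i z].
  case: s => z n; have [z' [zz' Dz']] := (DP i).2 z n; have [m h] := (DP i).1 z' Dz'.
  exists (z', maxn m n.+1); split=> //=; first by lia.
  by move=> z'' h'; apply: h; apply: agree_le h'; lia.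
have [f fP] := choice (fun q : nat * (C * nat) => step q.1 q.2).
pose s := fix s i := if i is i.+1 then f (i, s i) else (z0, n0).
have sP i := fP (i, s i).
have sn i : i <= (s i).2 by elim: i => // i IH; have [/= ? _ _] := sP i; lia.
have sle i d : (s i).2 <= (s (d + i)).2 /\ agree (s i).2 (s i).1 (s (d + i)).1.
  elim: d => // d [IH1 IH2]; have [/= h1 h2 _] := sP (d + i); split; first by lia.
  by apply: (agree_trans IH2); apply: agree_le h2.
(* Stage [i] fixes at least [i] bits, so bit [j] is final from stage [j.+1] on. *)
pose w j := (s j.+1).1 j.
have sw i : agree (s i).2 (s i).1 w.
  move=> j ji; rewrite /w; have [ij|ij] := leqP i j.+1.
    by have [_ /(_ j ji)] := sle i (j.+1 - i); rewrite subnK.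
  have [_ h] := sle j.+1 (i - j.+1); rewrite subnK in h; last by lia.
  by apply/esym/h; exact: sn.
exists w; split; first exact: (sw 0).
by move=> i; have [_ _ h] := sP i; apply: h; exact: (sw i.+1).
Qed.

Definition flip k z : C := fun i => if i == k then ~~ z i else z i.

Lemma flipK k : involutive (flip k).
Proof. by move=> z; apply/funext => i; rewrite /flip; case: eqP => //; rewrite negbK. Qed.

Lemma flip_agree k n z z' : agree n z z' -> agree n (flip k z) (flip k z').
Proof. by move=> h i /h e; rewrite /flip e. Qed.

(** Membership in [O] is constant on some basic open set given by [n0] bits (any one if [O] is
    empty), which flipping bit [n0] preserves. A point [z] of it such that [z] and its flip are both
    generic then contradicts the flip rule. *)
Lemma no_flip_set Z : baire_property Z -> ~ (forall k z, Z (flip k z) <-> ~ Z z).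
Proof.
move=> [O [oO [D [DP DO]]]] flipZ.
have [z0 [n0 O0]] : exists z0 n0, forall z z', agree n0 z0 z -> agree n0 z0 z' -> O z <-> O z'.
  have [[z /oO[n h]]|none] := pselect (exists z, O z); first by exists z, n => z1 z2 /h + /h.
  by exists xpred0, 0 => z z' _ _; split=> ?; exfalso; apply: none; [exists z|exists z'].
have dP i : copen (fun z => D i z /\ D i (flip n0 z)) /\ cdense (fun z => D i z /\ D i (flip n0 z)).
  have [oD dD] := DP i; split=> [z [/oD[n h] /oD[n' h']]|z n].
    exists (maxn n n') => z' zz'; split; [apply: h|apply: h'].
      by apply: agree_le zz'; lia.
    by apply: flip_agree; apply: agree_le zz'; lia.
  have [z1 [zz1 /oD[m h]]] := dD z n.
  have [z2 [zz2 Dz2]] := dD (flip n0 z1) (maxn n m).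
  have zz3 := flip_agree n0 zz2; rewrite flipK in zz3.
  exists (flip n0 z2); rewrite flipK; split; last first.
    by split=> //; apply: h; apply: agree_le zz3; lia.
  by apply: (agree_trans zz1); apply: agree_le zz3; lia.
have [z [zz0 Dz]] := baire_category z0 n0 dP.
have Zz := DO z (fun i => (Dz i).1); have Zf := DO _ (fun i => (Dz i).2).
have zf : agree n0 z0 (flip n0 z).
  by move=> i ni; rewrite /flip ifF ?zz0//; lia.
by have := flipZ n0 z; have := O0 _ _ zz0 zf; tauto.
Qed.

End Cantor.

(** * The Wadge game for a refining sequence of equivalence relations *)

Section Wadge.
Variables (X : Type) (x0 : X) (e : nat -> X -> X -> Prop).
Hypothesis e_refl : forall n x, e n x x.
Hypothesis e_sym : forall n x y, e n x y -> e n y x.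
Hypothesis e_trans : forall n x y z, e n x y -> e n y z -> e n x z.
Hypothesis e0 : forall x y, e 0 x y.
Hypothesis eS : forall n x y, e n.+1 x y -> e n x y.
Hypothesis e_sep : forall x y, (forall n, e n x y) -> x = y.
Hypothesis e_complete : forall u : nat -> X, (forall n, e n (u n) (u n.+1)) ->
  exists x, forall n, e n x (u n).
Implicit Types (A B : X -> Prop) (u : nat -> X).

Definition eopen A := forall x, A x -> exists n, forall y, e n x y -> A y.

(** An inductive form, because determinacy and the Baire property are both proved by induction on
    how the set is generated. *)
Inductive borel : (X -> Prop) -> Prop :=
| borel_open A : eopen A -> borel A
| borel_compl A : borel A -> borel (fun x => ~ A x)
| borel_bigcup (A : nat -> X -> Prop) :
    (forall i, borel (A i)) -> borel (fun x => exists i, A i x).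

Definition elimit u := some_such x0 (fun x => forall n, e n x (u n)).

Lemma elimitP u : (forall n, e n (u n) (u n.+1)) -> forall n, e n (elimit u) (u n).
Proof. by move=> /e_complete/(some_suchP x0). Qed.

Lemma elimitunique u x : (forall n, e n x (u n)) -> elimit u = x.
Proof.
move=> xu; have /(some_suchP x0) h : exists x, forall n, e n x (u n) by exists x.
by apply: e_sep => n; apply: e_trans (h n) _; exact: e_sym.
Qed.

Lemma e_le m n x y : m <= n -> e n x y -> e m x y.
Proof. by move=> mn; rewrite -(subnK mn); elim: (n - m) => // d IH /eS. Qed.

Lemma baire_borel A (h : (nat -> bool) -> X) : borel A ->
  (forall z n, exists m, forall z', agree m z z' -> e n (h z) (h z')) ->
  baire_property (fun z => A (h z)).
Proof.
move=> bA hc; elim: bA => {}A => [oA|_ IH|_ IH]; [|exact: baire_compl|exact: baire_bigcup].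
apply: baire_open => z Ahz; have [n hn] := oA _ Ahz; have [m hm] := hc z n.
by exists m => z' /hm /hn.
Qed.

Lemma unravelable_borel (T : tree) A (h : (nat -> T) -> X) : borel A ->
  (forall x n, play x -> exists m, forall y, play y -> y m = x m -> e n (h x) (h y)) ->
  unravelable (fun x => A (h x)).
Proof.
move=> bA hc; elim: bA => {}A => [oA|_ IH|_ IH];
  [|exact: unravelable_compl|exact: unravelable_bigcup].
apply: unravelable_open => x px Ahx; have [n hn] := oA _ Ahx.
by have [m hm] := hc x n px; exists m => y py yx; apply: hn; exact: hm.
Qed.

(* Positions list the moves, last one first; each player's moves form a sequence
   whose [n]-th term fixes a class of [e n]. *)
Fixpoint wlegal (v : seq X) := if v is m :: v' then
  wlegal v' /\ (1 < size v' -> e (size v').-2./2 (nth x0 v' 1) m) else True.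

Lemma wlegal_behead v : wlegal v -> wlegal (behead v).
Proof. by case: v => //= m v []. Qed.

Lemma wlegal_child v : wlegal v ->
  exists w, [/\ wlegal w, size w = (size v).+1 & behead w = v].
Proof. by move=> lv; exists (nth x0 v 1 :: v). Qed.

Definition wtree : tree := @Tree (seq X) [::] wlegal size behead
  (@size_behead X) wlegal_behead wlegal_child.

Definition wmove (z : nat -> wtree) n := head x0 (z n.+1).

Lemma wplay_cons (z : nat -> wtree) n : play z -> z n.+1 = wmove z n :: z n.
Proof.
move=> pz; have [_ _ <-] := pz n; have := play_lvl n.+1 pz.
by rewrite /wmove /=; case: (z n.+1).
Qed.

Lemma wplay_size (z : nat -> wtree) n : play z -> size (z n) = n.
Proof. exact: (@play_lvl wtree). Qed.

Lemma wmove_chain (z : nat -> wtree) n : play z -> e n./2 (wmove z n) (wmove z n.+2).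
Proof.
move=> pz; have : wlegal (z n.+3) by exact: (@play_legal wtree).
rewrite (wplay_cons n.+2 pz) /= wplay_size// => -[_ /(_ isT)].
by rewrite (wplay_cons n.+1 pz) (wplay_cons n pz).
Qed.

Definition wlim (b : bool) (z : nat -> wtree) := elimit (fun j => wmove z (b + j.*2)).

Lemma wlimP b z n : play z -> e n (wlim b z) (wmove z (b + n.*2)).
Proof.
move=> pz; apply: (@elimitP (fun j => wmove z (b + j.*2))) => j.
have := wmove_chain (b + j.*2) pz; rewrite half_bit_double.
by rewrite doubleS !addnS.
Qed.

Lemma wlim_continuous b (z : nat -> wtree) n : play z ->
  exists m, forall y, play y -> y m = z m -> e n (wlim b z) (wlim b y).
Proof.
move=> pz; exists (b + n.*2).+1 => y py yz; apply: e_trans (wlimP b n pz) _.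
apply: e_sym; rewrite -(_ : wmove y (b + n.*2) = wmove z (b + n.*2)); first exact: wlimP.
by rewrite /wmove yz.
Qed.

Fixpoint run b (s : wtree -> wtree) u n : wtree :=
  if n is n.+1 then if odd n == b then s (run b s u n) else u n./2 :: run b s u n
  else [::].

Lemma run_own b s u n : odd n = b -> run b s u n.+1 = s (run b s u n).
Proof. by move=> /= ->; rewrite eqxx. Qed.

Lemma run_opp b s u n : odd n <> b -> run b s u n.+1 = u n./2 :: run b s u n.
Proof. by move=> /= /eqP/negbTE ->. Qed.

Lemma run_step b s u n : strategy b s -> wlegal (run b s u n) -> size (run b s u n) = n ->
  [/\ odd n = b -> wlegal (run b s u n.+1), size (run b s u n.+1) = n.+1
    & behead (run b s u n.+1) = run b s u n].
Proof.
move=> ss ln sn; have [on|on] := eqVneq (odd n) b.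
  rewrite run_own//; have [|l1 l2 l3] := ss (run b s u n) ln; first by rewrite /= sn.
  by split=> //; exact: (etrans l2 (congr1 S sn)).
by rewrite run_opp; [split; rewrite /= ?sn//; move/eqP: on|apply/eqP].
Qed.

Lemma run_play b s u : strategy b s -> (forall n, e n (u n) (u n.+1)) ->
  play (run b s u).
Proof.
move=> ss uc.
have h n m : m <= n -> wlegal (run b s u m) /\ size (run b s u m) = m.
  elim: n m => [|n IH] m; first by rewrite leqn0 => /eqP->.
  have [E|ne] := eqVneq m n.+1; last by move=> mn; apply: IH; lia.
  move=> _; rewrite {}E; have [ln sn] := IH n (leqnn n).
  have [l1 l2 l3] := run_step (u := u) ss ln sn; split=> //.
  have [/l1//|/eqP on] := eqVneq (odd n) b.
  rewrite run_opp//=; split=> //; rewrite sn => n1.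
  case: n n1 on ln sn IH {l1 l2 l3} => [//|[//|k]] _; rewrite /= negbK => ok _ _ IH.
  have [lk sk] := IH k.+1 (leqnSn _); have [_ _ bk] := run_step (u := u) ss lk sk.
  by rewrite -[(if _ then _ else _)]/(run b s u k.+2) -nth_behead bk run_opp.
by move=> n; have [l1 l2] := h n n (leqnn n); have [_ _ l3] := run_step (u := u) ss l1 l2.
Qed.

Lemma run_follows b s u : follows b s (run b s u).
Proof. by move=> n; exact: run_own. Qed.

Lemma run_local b s u u' m :
  (forall n, n < m -> odd n <> b -> u n./2 = u' n./2) -> run b s u m = run b s u' m.
Proof.
elim: m => // m IH uu'; have {}IH : run b s u m = run b s u' m.
  by apply: IH => n nm; apply: uu'; lia.
have [on|/eqP on] := eqVneq (odd m) b; first by rewrite !run_own// IH.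
by rewrite !run_opp// IH uu'.
Qed.

Lemma run_opp_lim b s u x : strategy b s -> (forall n, e n x (u n)) ->
  wlim (~~ b) (run b s u) = x.
Proof.
move=> ss xu; apply: elimitunique => n.
rewrite /wmove run_opp ?half_bit_double//.
by rewrite oddD odd_double addbF oddb; case: (b).
Qed.

(** The opponent plays representatives of classes instead of [x] itself, so that close points
    produce literally equal moves and hence equal replies. *)
Definition rep n x := some_such x (e n x).

Lemma repP n x : e n x (rep n x).
Proof. by apply: some_suchP; exists x. Qed.

Lemma rep_eq n x y : e n x y -> rep n x = rep n y.
Proof.
move=> xy; rewrite /rep (_ : e n x = e n y).
  by apply: some_such_default; exists y.
by apply/funext => z; apply/propext; split; apply: e_trans => //; exact: e_sym.
Qed.

Definition respond b s x := wlim b (run b s (fun n => rep n x)).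

Lemma rep_chain x n : e n (rep n x) (rep n.+1 x).
Proof.
by apply: e_trans (e_sym (repP n x)) _; apply: eS; exact: repP.
Qed.

(** Move [~~ b + n] of player [b] is preceded exactly by the opponent's moves [0] to [n], which are
    the same for [x] and [y]. *)
Lemma respond_close b s x y n : strategy b s -> e n x y ->
  e (~~ b + n) (respond b s x) (respond b s y).
Proof.
move=> ss xy; have px z := run_play ss (rep_chain z).
apply: e_trans (wlimP b _ (px x)) _; apply: e_sym.
rewrite (_ : wmove _ _ = wmove (run b s (fun n => rep n y)) (b + (~~ b + n).*2)); first exact: wlimP.
rewrite /wmove; congr head; apply: run_local => m mn om; apply: rep_eq.
apply: e_le xy; move: mn om; case: (b) => /=; rewrite -[m in odd m]odd_double_half; lia.
Qed.

Theorem wadge A B : borel A -> borel B ->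
  (exists f, (forall n x y, e n x y -> e n (f x) (f y)) /\ forall x, A x <-> B (f x)) \/
  (exists g, (forall n x y, e n x y -> e n.+1 (g x) (g y)) /\ forall y, ~ B y <-> A (g y)).
Proof.
move=> bA bB; pose Y (z : nat -> wtree) := ~ (A (wlim false z) <-> B (wlim true z)).
have uY : unravelable Y.
  have uA : unravelable (fun z : nat -> wtree => A (wlim false z)).
    by apply: unravelable_borel => // z n; exact: wlim_continuous.
  have uB : unravelable (fun z : nat -> wtree => B (wlim true z)).
    by apply: unravelable_borel => // z n; exact: wlim_continuous.
  apply: unravelable_ext (unravelable_or
    (unravelable_compl (unravelable_or uA (unravelable_compl uB)))
    (unravelable_compl (unravelable_or uB (unravelable_compl uA)))) => z _.
  by rewrite /Y; have := EM (A (wlim false z)); have := EM (B (wlim true z)); tauto.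
have [||[s [ss sw]]|[s [ss sw]]] := @determinacy wtree [::] Y _ _ uY => //.
- by case.
- right; exists (respond false s); split=> [n x y|y]; first exact: (respond_close (b := false)).
  have := sw _ (run_play ss (rep_chain y)) (@run_follows _ _ _); rewrite /Y.
  have -> := @run_opp_lim false s _ y ss (fun n => repP n y).
  rewrite -/(respond false s y); have := EM (A (respond false s y)); have := EM (B y); tauto.
- left; exists (respond true s); split=> [n x y|x]; first exact: (respond_close (b := true)).
  have /contrapT := sw _ (run_play ss (rep_chain x)) (@run_follows _ _ _).
  by have -> := @run_opp_lim true s _ x ss (fun n => repP n x).
Qed.

(** * The Martin-Monk contradiction *)

Section MartinMonk.
Variables (A : nat -> X -> Prop) (g : nat -> bool -> X -> X).
Hypothesis bA : borel (A 0).
Hypothesis g_contract : forall i b n x y, e n x y -> e n.+1 (g i b x) (g i b y).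
Hypothesis gP : forall i b x, A i (g i b x) <-> (if b then A i.+1 x else ~ A i.+1 x).
Implicit Type z : nat -> bool.

Fixpoint approx z m i := if m is m.+1 then g i (z i) (approx z m i.+1) else x0.

Definition point z i := elimit (fun m => approx z m i).

Lemma pointP z i m : e m (point z i) (approx z m i).
Proof.
apply: (@elimitP (fun m => approx z m i)) => {}m.
by elim: m i => [|m IH] i //=; apply: g_contract; exact: IH.
Qed.

Lemma pointE z i : point z i = g i (z i) (point z i.+1).
Proof.
apply: e_sep => -[//|m]; apply: e_trans (pointP z i m.+1) _.
by apply: e_sym; apply: g_contract; exact: pointP.
Qed.

Lemma approx_local z z' m i : (forall j, i <= j < i + m -> z j = z' j) ->
  approx z m i = approx z' m i.
Proof.
elim: m i => //= m IH i zz'; rewrite zz' ?IH//; first by move=> j ij; apply: zz'; lia.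
by lia.
Qed.

(** Points of index above [k] do not see bit [k]; at [k] the flip replaces the condition in [gP] by
    its negation; each lower step transforms membership in the same way for both sequences. *)
Lemma point_flip z k i : i <= k -> A i (point (flip k z) i) <-> ~ A i (point z i).
Proof.
move=> ik; rewrite -(subKn ik); elim: (k - i) => [|d IH].
  rewrite subn0 (pointE (flip k z)) (pointE z) !gP (_ : point (flip k z) k.+1 = point z k.+1).
    by rewrite /flip eqxx; have := EM (A k.+1 (point z k.+1)); case: (z k) => /=; tauto.
  by congr elimit; apply/funext => m; apply: approx_local => j jk; rewrite /flip ifF//; lia.
have [kd|dk] := leqP k d; first by rewrite (_ : k - d.+1 = k - d)//; lia.
rewrite (pointE (flip k z)) (pointE z) !gP (_ : (k - d.+1).+1 = k - d); last by lia.
have -> : flip k z (k - d.+1) = z (k - d.+1) by rewrite /flip ifF//; lia.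
by have := IH; have := EM (A (k - d) (point z (k - d))); case: (z _); tauto.
Qed.

Lemma martin_monk : False.
Proof.
apply: (@no_flip_set (fun z => A 0 (point z 0))); last by move=> k z; exact: point_flip.
apply: baire_borel => // z n; exists n => z' zz'.
apply: e_trans (pointP z 0 n) _; apply: e_sym.
rewrite (_ : approx z n 0 = approx z' n 0); first exact: pointP.
by apply: approx_local => j jn; apply: zz'; lia.
Qed.

End MartinMonk.

End Wadge.

(** * Ultrametric Polish spaces *)

Import Order.TTheory GRing.Theory Num.Theory.
Local Open Scope classical_set_scope.
Local Open Scope ring_scope.

Section Ultrametric.
Variables (R : realType) (X : metricType R) (D : R).
Hypotheses (D0 : 0 < D) (um : ultrametric X) (cX : complete X).

Definition rad n : R := D / 2 ^+ n.

Lemma rad_gt0 n : 0 < rad n.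
Proof. by rewrite divr_gt0// exprn_gt0. Qed.

Lemma radS n : rad n.+1 = rad n / 2.
Proof. by rewrite /rad exprS invfM mulrA mulrAC. Qed.

Lemma rad_small eps : 0 < eps -> exists n, rad n < eps.
Proof.
move=> eps0; exists (Num.truncn (D / eps)).+1.
have : D / eps < 2 ^+ (Num.truncn (D / eps)).+1.
  apply: lt_trans (truncnS_gt _) _.
  by rewrite -natrX ltr_nat ltn_expl.
by rewrite /rad ltr_pdivrMr// mulrC -ltr_pdivrMr// exprn_gt0.
Qed.

(* All points are close at level [0], even in unbounded spaces: the iteration of
   contractions in the Martin-Monk argument can then start anywhere. *)
Definition close n (x y : X) := n = 0%N \/ mdist x y <= rad n.

Lemma close_refl n x : close n x x.
Proof. by right; rewrite mdistxx ltW// rad_gt0. Qed.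

Lemma close_sym n x y : close n x y -> close n y x.
Proof. by case=> h; [left|right; rewrite metric_sym]. Qed.

Lemma close_trans n x y z : close n x y -> close n y z -> close n x z.
Proof.
move=> [->|h1]; first by left.
move=> [->|h2]; first by left.
by right; rewrite (le_trans (um x y z))// ge_max h1.
Qed.

Lemma close0 x y : close 0 x y.
Proof. by left. Qed.

Lemma closeS n x y : close n.+1 x y -> close n x y.
Proof.
case=> // h; right; apply: (le_trans h).
by rewrite radS; have := rad_gt0 n; lra.
Qed.

Lemma close_dist x y eps : 0 < eps -> (forall n, close n x y) -> mdist x y < eps.
Proof.
move=> eps0 h; have [n rn] := rad_small eps0.
have [//|h'] := h n.+1; apply: le_lt_trans h' _; rewrite radS.
by have := rad_gt0 n; lra.
Qed.

Lemma close_sep x y : (forall n, close n x y) -> x = y.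
Proof.
move=> h; apply: mdist_positivity; apply/eqP; rewrite eq_le mdist_ge0 andbT leNgt.
by apply/negP => d0; have := close_dist d0 h; rewrite ltxx.
Qed.

Lemma close_complete (u : nat -> X) : (forall n, close n (u n) (u n.+1)) ->
  exists x, forall n, close n x (u n).
Proof.
move=> uc.
have um' n m : (n <= m)%N -> close n (u n) (u m).
  elim: m => [|m IH] nm; first by left; move: nm; rewrite leqn0 => /eqP.
  have [->|ne] := eqVneq n m.+1; first exact: close_refl.
  have nm' : (n <= m)%N by lia.
  apply: close_trans (IH nm') _; move: (uc m).
  by apply: (e_le closeS).
have [|x ux] := cX (u := u).
  apply/cauchy_ballP => eps eps0; have [n rn] := rad_small eps0.
  pose A := [set x | close n.+1 (u n.+1) x].
  have uA : (u @ \oo) A by exists n.+1 => // m /= nm; exact: um'.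
  exists (A, A) => //= -[x y] [/= Ax Ay]; rewrite ballEmdist /=.
  have [//|h] := close_trans (close_sym Ax) Ay.
  by apply: le_lt_trans h _; rewrite radS; have := rad_gt0 n; lra.
exists x => n; have /cvg_ballP/(_ _ (rad_gt0 n))[m _ h] := ux.
(* Goes through a term of index beyond both [n] and [m], which is near the limit and close to
   [u n]. *)
apply: close_trans (close_sym (um' n (maxn n m) (leq_maxl _ _))).
by right; apply: ltW; have := h _ (leq_maxr n m); rewrite /= ballEmdist.
Qed.

Lemma Borel_borel (A : set X) : Borel A -> borel close A.
Proof.
apply: (@smallest_sub _ (sigma_algebra setT) (@open X) [set A | borel close A]); last first.
  move=> U oU; apply: borel_open => x Ux.
  have : nbhs x U by exact: open_nbhs_nbhs.
  move=> /nbhs_ballP[eps /= eps0 h]; have [n rn] := rad_small eps0.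
  exists n.+1 => y [//|xy]; apply: h; rewrite ballEmdist /=; apply: le_lt_trans xy _.
  by rewrite radS; have := rad_gt0 n; lra.
split.
- by apply: borel_open => x [].
- move=> B bB; rewrite (_ : _ `\` _ = (fun x => ~ B x)); first exact: borel_compl.
  by apply/seteqP; split=> x /=; [case|].
- move=> F bF; rewrite (_ : \bigcup_k F k = (fun x => exists i, F i x)).
    exact: borel_bigcup.
  by apply/seteqP; split=> x; [case=> i _ Fi; exists i|case=> i Fi; exists i].
Qed.

Definition nonexpansive (f : X -> X) := forall n x y, close n x y -> close n (f x) (f y).

Lemma nonexpansive_UCont f : nonexpansive f -> UCont f.
Proof.
move=> fn; apply/unif_continuousP => eps eps0; have [n rn] := rad_small eps0.
(* The index is a successor so that [close] bounds the distance; at level 0 it says nothing. *)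
exists (rad n.+1); first exact: rad_gt0.
move=> [x y] /=; rewrite !ballEmdist /= => xy.
have [//|h] := fn n.+1 x y (or_intror (ltW xy)); apply: le_lt_trans h _.
by rewrite radS; have := rad_gt0 n; lra.
Qed.

(** Rounding costs the factor 2: if [rad n.+1 < mdist x y <= rad n], the images are within [rad n],
    which is twice [rad n.+1]. *)
Lemma nonexpansive_Lip f : (forall x y : X, mdist x y <= D) -> nonexpansive f -> Lip f.
Proof.
move=> bD fn; exists 2 => // x y.
have [->|/eqP xy] := eqVneq x y; first by rewrite !mdistxx mulr0.
have d0 : 0 < mdist x y.
  rewrite lt_neqAle mdist_ge0 andbT eq_sym; apply/eqP => /mdist_positivity/xy; exact.
have : exists n, `[< ~ mdist x y <= rad n >].
  by have [n rn] := rad_small d0; exists n; apply/asboolP/negP; rewrite -ltNge.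
move=> exn; case: (ex_minnP exn) => -[|n] /asboolP/negP; rewrite -ltNge => rn nmin.
  by have := bD x y; rewrite leNgt => /negP; case; rewrite /rad expr0 divr1 in rn.
have xyn : mdist x y <= rad n.
  by apply: contrapT => /asboolP/nmin; rewrite ltnn.
have fxy : mdist (f x) (f y) <= rad n.
  (* At level 0 the bound on the images comes from the diameter, since [close] gives none. *)
  case: n rn nmin xyn => [|n] rn nmin xyn; first by rewrite /rad expr0 divr1.
  by have [//|] := fn n.+1 x y (or_intror xyn).
by apply: le_trans fxy _; move: rn; rewrite radS; lra.
Qed.

Lemma very_good (x0 : X) (F : set (X -> X)) : reducibility_class F ->
  (forall f, nonexpansive f -> F f) -> very_good_hierarchy F (@Borel R X).
Proof.
move=> [Fid Fcomp] Fne.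
have W := wadge x0 close_refl close_sym close_trans close0 closeS close_sep close_complete.
have shrink g : (forall n x y, close n x y -> close n.+1 (g x) (g y)) -> nonexpansive g.
  by move=> gc n x y xy; apply: closeS; exact: gc.
split=> [A B bA bB|[A bA Adesc]].
  have [[f [fn fP]]|[g [gn gP]]] := W A B (Borel_borel bA) (Borel_borel bB).
    left; exists f; first exact: Fne.
    by apply/seteqP; split=> x /= /fP.
  right; exists g; first by apply: Fne; exact: shrink.
  by apply/seteqP; split=> x /= /gP.
have redT P Q S : reducible F P Q -> reducible F Q S -> reducible F P S.
  by move=> [f Ff ->] [g Fg ->]; exists (g \o f); [exact: Fcomp|].
have redC P Q : reducible F P Q -> reducible F (~` P) (~` Q).
  by move=> [f Ff ->]; exists f.
(* If [A i] reduced to the complement of [A i.+1], so would [A i.+1]; by complementation that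
   complement reduces to [A i.+1], and then so does [A i]. *)
have nred i : ~ reducible F (A i) (A i.+1) /\ ~ reducible F (A i) (~` A i.+1).
  have [le nle] := Adesc i; split=> // h; apply: nle.
  apply: (redT _ _ _ h); have := redC _ _ (redT _ _ _ le h).
  by rewrite setCK.
have ex (ib : nat * bool) : exists g, (forall n x y, close n x y -> close n.+1 (g x) (g y)) /\
    forall x, A ib.1 (g x) <-> (if ib.2 then A ib.1.+1 x else ~ A ib.1.+1 x).
  case: ib => i b /=.
  (* I's strategies reduce the complement of the second set, so it is complemented when [b]
     holds. *)
  have bor : borel close (if b then ~` A i.+1 else A i.+1).
    by case: b; [apply: borel_compl|]; exact: Borel_borel.
  have [[f [fn fP]]|[g [gn gP]]] := W _ _ (Borel_borel (bA i)) bor.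
    have [n1 n2] := nred i; exfalso; case: b {bor} fP => fP; [apply: n2|apply: n1];
      exists f; try exact: Fne; by apply/seteqP; split=> x /= /fP.
  exists g; split=> // x; rewrite -gP; case: (b) => //=; split=> [/contrapT//|h]; exact.
have [g gP] := choice ex.
apply: (martin_monk x0 close_sym close_trans close0 close_sep close_complete
  (A := A) (g := fun i b => g (i, b))).
- exact: Borel_borel.
- by move=> i b; exact: (gP (i, b)).1.
- by move=> i b; exact: (gP (i, b)).2.
Qed.

End Ultrametric.

(** The game needs a point [x0]; in an empty space all subsets coincide and reduce to each other. *)
Lemma very_good_empty (T : Type) (F : set (T -> T)) (Gamma : set (set T)) :
  (T -> False) -> F id -> very_good_hierarchy F Gamma.
Proof.
move=> T0 Fid.
have red A B : reducible F A B.
  by exists id => //; apply/seteqP; split=> x; case: (T0 x).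
split=> [A B _ _|[A _ /(_ 0%N)[_]]]; [by left|exact].
Qed.

Theorem theorem3p10 (R : realType) (X : metricType R)
    (polishX : ultrametric_Polish X) :
  very_good_hierarchy (@UCont R X) (@Borel R X) /\
  (bounded_diameter X -> very_good_hierarchy (@Lip R X) (@Borel R X)).
Proof.
have [um cX _] := polishX.
have [[x0]|X0] := pselect (inhabited X); last first.
  have X0' (x : X) : False by apply: X0.
  by split=> [|_]; apply: very_good_empty => //;
    [case: (UCont_reducibility_class X)|case: (Lip_reducibility_class X)].
split=> [|[D0 bD]].
  (* Any scale works here, as uniform continuity concerns only small distances. *)
  apply: (very_good (D := 1)) => //; first exact: UCont_reducibility_class.
  by move=> f; exact: nonexpansive_UCont.
(* The scale must be positive, and [D0] may fail to be so when the space is a single point. *)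
pose D := Num.max 1 D0.
have D_gt0 : 0 < D by rewrite lt_max ltr01.
apply: (very_good D_gt0) => //; first exact: Lip_reducibility_class.
move=> f; apply: nonexpansive_Lip => // x y.
by rewrite /D le_max; apply/orP; right; apply: bD; exists x => //; exists y.
Qed.
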